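(* Let $p>0$ be a constant, let $K:[0,1]\times\mathbb{R}\to\mathbb{R}$ be a function and $L:H^2(0,1)\cap H_0^1(0,1)\to\mathbb{R}$ a functional satisfying $|L(w)|\le\|w\|$ and $|K(x,y)|\le|y|$ for all $x\in[0,1]$, $y\in\mathbb{R}$, $w\in H^2(0,1)\cap H_0^1(0,1)$. Consider the system $$w_t(t,x)=p\,w_{xx}(t,x)+\theta_1(t)K(x,y(t)),\quad w(t,0)=w(t,1)=0,\qquad \dot y=u+\theta_2(t)L(w[t])+d(t),$$ with the controller $$u=-c\Big(1+\frac{(b+\exp(z))^7}{4a^6}\Big)(y^7+y^3+y),\qquad \dot z=\Gamma\exp(-z)\big(y^2/2-\varepsilon\big)^+,$$ where $\varepsilon,\Gamma>0$, $c\ge1$, $b\ge1\ge a>0$ are constants. Let $d\in L^\infty(\mathbb{R}_+)$ and $\theta=(\theta_1,\theta_2)\in C^0(\mathbb{R}_+;\mathbb{R}^2)\cap L^\infty(\mathbb{R}_+;\mathbb{R}^2)$. Let $w\in C^0(\mathbb{R}_+;L^2(0,1))\cap C^1((0,+\infty);L^2(0,1))\cap C^0((0,+\infty);H^2(0,1)\cap H_0^1(0,1))$, $z\in C^1(\mathbb{R}_+;\mathbb{R})$, and $y\in C^0(\mathbb{R}_+;\mathbb{R})$ absolutely continuous on every compact interval of $\mathbb{R}_+$, be such that the PDE, the formula for $u$ and the equation for $\dot z$ hold for all $t\in(0,+\infty)$, and the equation for $\dot y$ holds for a.e. $t\in(0,+\infty)$. Then for all $t\ge0$: $$\|w[t]\|^2+y^2(t)\le\exp(-\kappa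 t)\big(\|w[0]\|^2+y^2(0)\big)+2a\frac{\|d\|_\infty^2+\|\theta\|_\infty^8+2p^{-2}}{b\kappa}+\frac{\|\theta\|_\infty^4}{2p^2\pi^4\kappa},$$ $$z(0)\le z(t)\le\ln\Big(\exp(z(0))+\bar B\big(\|d\|_\infty^2+\|\theta\|_\infty^4+\|\theta\|_\infty^8+2p^{-2}+\|w[0]\|^2+y^2(0)\big)\Big),$$ $$\limsup_{t\to+\infty}\|w[t]\|\le\frac{\sqrt{2\varepsilon}}{p\pi^2}\limsup_{t\to+\infty}|\theta_1(t)|,\qquad \limsup_{t\to+\infty}|y(t)|\le\sqrt{2\varepsilon},$$ where $\kappa=\min\big(\frac{p\pi^2}{2},2c\big)$, $\bar K=\frac{4p\pi^2(b\kappa+ap\pi^2)+2b\kappa p^2\pi^4+b}{4p\pi^2b\kappa}$ and $\bar B=\frac{a\bar K(\varepsilon\Gamma+2c)+\varepsilon c\Gamma}{4c^2\varepsilon}$.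
   Context: $\|\cdot\|$ denotes the norm of $L^2(0,1)$; $w[t]$ denotes the function $x\mapsto w(t,x)$. $H^k(0,1)$ is the Sobolev space and $H_0^1(0,1)$ the closure in $H^1(0,1)$ of compactly supported $C^1$ functions. $\|d\|_\infty$, $\|\theta\|_\infty$ denote essential suprema of $|d(t)|$ and of the Euclidean norm $|\theta(t)|$. $x^+=\max(x,0)$. *)

(* Defs.v *)
From HB Require Import structures.
From mathcomp Require Import all_boot all_order all_algebra.
From mathcomp Require Import all_classical all_reals all_analysis.
From mathcomp Require Import ess_sup_inf.
Set Implicit Arguments. Unset Strict Implicit. Unset Printing Implicit Defensive.
Import Order.TTheory GRing.Theory Num.Theory Num.Def.
Import numFieldNormedType.Exports.
Local Open Scope classical_set_scope.
Local Open Scope ring_scope.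

Section defs.
Variable R : realType.
Local Notation mu := (@lebesgue_measure R).
Local Notation I01 := (`[0%R, 1%R]%classic : set R).

Definition L2mem (f : R -> R) : Prop :=
  measurable_fun I01 f /\
  mu.-integrable I01 (fun x => ((f x) ^+ 2)%:E).

Definition L2norm (f : R -> R) : R :=
  Num.sqrt (fine (\int[mu]_(x in I01) ((f x) ^+ 2)%:E)).

Definition testfun (phi : R -> R) : Prop :=
  (forall x, derivable phi x 1) /\ continuous (derive1 phi) /\
  exists a b : R, 0 < a /\ b < 1 /\ forall x, x < a \/ b < x -> phi x = 0.

Definition weak_deriv (f g : R -> R) : Prop :=
  forall phi, testfun phi ->
    (\int[mu]_(x in I01) (f x * derive1 phi x)%:E =
     - \int[mu]_(x in I01) (g x * phi x)%:E)%E.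

(* f (with weak derivative f1) lies in H_0^1(0,1): closure of test functions
   in the H^1 norm *)
Definition H01approx (f f1 : R -> R) : Prop :=
  exists phi : nat -> R -> R, (forall n, testfun (phi n)) /\
    (fun n => L2norm (fun x => phi n x - f x)) @ \oo --> 0 /\
    (fun n => L2norm (fun x => derive1 (phi n) x - f1 x)) @ \oo --> 0.

Definition inH2H01 (f f1 f2 : R -> R) : Prop :=
  L2mem f /\ L2mem f1 /\ L2mem f2 /\ weak_deriv f f1 /\ weak_deriv f1 f2 /\
  H01approx f f1.

Definition H2H01 (f : R -> R) : Prop := exists f1 f2, inH2H01 f f1 f2.

Definition abs_cont_on (f : R -> R) (a b : R) : Prop :=
  forall e : R, 0 < e -> exists2 delta : R, 0 < delta &
    forall (n : nat) (s t : 'I_n -> R),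
      (forall i, a <= s i /\ s i <= t i /\ t i <= b) ->
      (forall i j, i != j -> t i <= s j \/ t j <= s i) ->
      \sum_(i < n) (t i - s i) < delta ->
      \sum_(i < n) `|f (t i) - f (s i)| < e.

Definition ess_sup_Rplus (f : R -> R) : \bar R :=
  ess_sup mu (fun t => if (0 <= t)%R then (`|f t|)%:E else 0%E).

Definition Linf_Rplus (f : R -> R) : Prop :=
  measurable_fun (`[0%R, +oo[%classic : set R) f /\ (ess_sup_Rplus f < +oo)%E.

Definition Linf_norm (f : R -> R) : R := fine (ess_sup_Rplus f).

Definition ppart (x : R) : R := Num.max x 0.

End defs.

(* Main.v *)
(* Write n = ||w||, v = y^2/2, Z = exp z, P = p pi^2 and r = a/(b + Z).

   Testing the heat equation with w, the weak formulation and Wirtinger's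
   inequality pi ||w|| <= ||w_x|| give (n^2)' <= -2 P n^2 + 2 |theta_1| n |y|,
   while y is absolutely continuous; a function of this class whose derivative
   is nonpositive almost everywhere is nonincreasing, which yields a Gronwall
   lemma. Young's inequality applied to (n^2 + y^2)' gives the first bound.

   That bound on n turns the y-equation into v' <= -2 c v + A/(b + Z) with
   A = a Kbar (...): the powers y^8, y^4 and the factor (b + Z)^7 of the
   controller absorb the coupling term theta_2 L(w) y at the price of r times
   constants. As Z' = Gamma (v - eps)^+, as soon as Z >= A/(2 c eps) the excess
   v - eps decays exponentially and Z can grow only by Gamma v/(2 c): this bounds
   Z. Since Z is then convergent and v' is bounded above, limsup v <= eps, and
   the energy inequality for n alone gives the limsup of n. *)

Require Import Defs.
From HB Require Import structures.
From mathcomp Require Import all_boot all_order all_algebra.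
From mathcomp Require Import all_classical all_reals all_analysis.
From mathcomp Require Import measurable_realfun ess_sup_inf.
From mathcomp Require Import ring lra.
Set Implicit Arguments.
Unset Strict Implicit.
Unset Printing Implicit Defensive.

Import Order.TTheory GRing.Theory Num.Theory Num.Def.
Import numFieldNormedType.Exports.
Local Open Scope classical_set_scope.
Local Open Scope ring_scope.

(* The generic instance is not inferred for the bare function [lebesgue_measure]. *)
#[local] Instance ae_lebesgue_filter (R : realType) :
  Filter (nbhs (almost_everywhere (@lebesgue_measure R))).
Proof. exact: (@ae_filter_ringOfSetsType _ (measurableTypeR R) R). Qed.

(** * The inner product and norm of L^2(0,1) *)

Section L2_inner_product.
Context {R : realType}.
Local Notation mu := (@lebesgue_measure R).
Local Notation I01 := (`[0%R, 1%R]%classic : set R).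
Implicit Types f g h : R -> R.

Let mI : measurable (I01 : set (measurableTypeR R)).
Proof. exact: measurable_itv. Qed.

(** [Rintegral] is a real number in all cases, so additivity and homogeneity are claimed only
    between functions in [L2mem], whose products are integrable. *)
Definition ip f g : R := \int[mu]_(x in I01) (f x * g x).

Lemma L2mem_integrableM f g : L2mem f -> L2mem g ->
  mu.-integrable I01 (EFin \o (fun x => f x * g x)).
Proof.
move=> [mf f2] [mg g2].
have := integrableD mI f2 g2; apply: le_integrable => //.
  by apply/measurable_EFinP; exact: measurable_funM.
move=> x _ /=; rewrite lee_fin [leRHS]ger0_norm ?addr_ge0 ?sqr_ge0//.
by rewrite ler_norml; apply/andP; split; nra.
Qed.

Lemma L2memP f : measurable_fun I01 f ->
  mu.-integrable I01 (EFin \o (fun x => f x * f x)) -> L2mem f.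
Proof. by move=> mf fi; split. Qed.

Lemma L2memZ k f : L2mem f -> L2mem (fun x => k * f x).
Proof.
move=> Lf.
apply: L2memP; first by apply: measurable_funM => //; exact: Lf.1.
have /(integrableZl mI (k * k)) := L2mem_integrableM Lf Lf.
by apply: eq_integrable => // x _ /=; rewrite -EFinM mulrACA.
Qed.

Lemma L2memD f g : L2mem f -> L2mem g -> L2mem (fun x => f x + g x).
Proof.
move=> Lf Lg; apply: L2memP; first by apply: measurable_funD; [exact: Lf.1|exact: Lg.1].
have ifg := L2mem_integrableM Lf Lg.
have := integrableD mI (integrableD mI (L2mem_integrableM Lf Lf) ifg)
  (integrableD mI ifg (L2mem_integrableM Lg Lg)).
apply: eq_integrable => // x _ /=; congr EFin; ring.
Qed.

Lemma L2memB f g : L2mem f -> L2mem g -> L2mem (fun x => f x - g x).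
Proof.
move=> Lf /(L2memZ (-1)) /(L2memD Lf).
by under eq_fun do rewrite mulN1r.
Qed.

Lemma ipC f g : ip f g = ip g f.
Proof. by rewrite /ip; under eq_Rintegral do rewrite mulrC. Qed.

Lemma ipDl f g h : L2mem f -> L2mem g -> L2mem h ->
  ip (fun x => f x + g x) h = ip f h + ip g h.
Proof.
move=> Lf Lg Lh; rewrite /ip -RintegralD//; last 2 first.
- exact: L2mem_integrableM.
- exact: L2mem_integrableM.
by under eq_Rintegral do rewrite mulrDl.
Qed.

Lemma ipZl k f h : L2mem f -> L2mem h ->
  ip (fun x => k * f x) h = k * ip f h.
Proof.
move=> Lf Lh; rewrite /ip -RintegralZl//; last exact: L2mem_integrableM.
by under eq_Rintegral do rewrite -mulrA.
Qed.

Lemma ipBl f g h : L2mem f -> L2mem g -> L2mem h ->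
  ip (fun x => f x - g x) h = ip f h - ip g h.
Proof.
move=> Lf Lg Lh.
rewrite (_ : (fun x => _) = (fun x => f x + (-1) * g x)); last first.
  by apply/funext => x; rewrite mulN1r.
by rewrite ipDl//; [rewrite ipZl// mulN1r|exact: L2memZ].
Qed.

Lemma ip_ge0 f : 0 <= ip f f.
Proof. by apply: Rintegral_ge0 => x _; rewrite -expr2 sqr_ge0. Qed.

Lemma L2normE f : L2norm f = Num.sqrt (ip f f).
Proof. by []. Qed.

Lemma L2norm_ge0 f : 0 <= L2norm f.
Proof. by rewrite L2normE sqrtr_ge0. Qed.

Lemma L2norm_sqr f : L2norm f ^+ 2 = ip f f.
Proof. by rewrite L2normE sqr_sqrtr// ip_ge0. Qed.

Lemma L2norm_sqrD f g : L2mem f -> L2mem g ->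
  L2norm (fun x => f x + g x) ^+ 2 =
  L2norm f ^+ 2 + 2 * ip f g + L2norm g ^+ 2.
Proof.
move=> Lf Lg; rewrite !L2norm_sqr ipDl//; last exact: L2memD.
set s := (X in ip f X + _).
rewrite (ipC f s) (ipC g s) /s !ipDl// (ipC g f); ring.
Qed.

Lemma L2normZ k f : L2mem f -> L2norm (fun x => k * f x) = `|k| * L2norm f.
Proof.
move=> Lf; apply/eqP; rewrite -(@eqrXn2 _ 2)// ?mulr_ge0 ?L2norm_ge0//.
rewrite exprMn !L2norm_sqr ipZl//; last exact: L2memZ.
rewrite ipC ipZl// real_normK ?num_real//; apply/eqP; ring.
Qed.

Lemma L2normN f : L2norm (fun x => - f x) = L2norm f.
Proof.
rewrite !L2normE; congr (Num.sqrt _); rewrite /ip.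
by under eq_Rintegral do rewrite mulrNN.
Qed.

Lemma L2norm_distC f g :
  L2norm (fun x => f x - g x) = L2norm (fun x => g x - f x).
Proof. by rewrite -L2normN; under eq_fun do rewrite opprB. Qed.

(** The squared norm of [s f + t g] is a nonnegative quadratic form in [(s, t)], and one well-chosen
    point in each case suffices. *)
Lemma cauchy_schwarz_ip f g : L2mem f -> L2mem g ->
  `|ip f g| <= L2norm f * L2norm g.
Proof.
move=> Lf Lg; set A := L2norm f; set B := L2norm g; set C := ip f g.
have A0 : 0 <= A by exact: L2norm_ge0.
have B0 : 0 <= B by exact: L2norm_ge0.
have H (s t : R) : 0 <= s ^+ 2 * A ^+ 2 + 2 * (s * t * C) + t ^+ 2 * B ^+ 2.
  have := sqr_ge0 (L2norm (fun x => s * f x + t * g x)).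
  rewrite L2norm_sqrD; [|exact: L2memZ..].
  rewrite !L2normZ// !exprMn !real_normK ?num_real// ipZl//; last exact: L2memZ.
  by rewrite (ipC f) ipZl// (ipC g) -/A -/B -/C !mulrA.
have [B00|Bn0] := eqVneq B 0.
  have : C ^+ 2 <= 0.
    (* For [B = 0] the form takes the value [C^2 A^2 - C^2 (A^2 + 1) = - C^2] at this point. *)
    have := H C (- (A ^+ 2 + 1) / 2); rewrite B00.
    rewrite expr0n/= mulr0 addr0; nra.
  have := sqr_ge0 C => C1 C2.
  have /eqP : C ^+ 2 = 0 by lra.
  by rewrite sqrf_eq0 => /eqP ->; rewrite normr0 mulr_ge0.
have Bp : 0 < B by rewrite lt_neqAle eq_sym Bn0.
(* Here the form equals [B^2 (A^2 B^2 - C^2)]. *)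
have := H (B ^+ 2) (- C) => HH.
have : C ^+ 2 <= (A * B) ^+ 2.
  rewrite -(@ler_pM2l _ (B ^+ 2)) ?exprn_gt0//; nra.
by rewrite -real_normK ?num_real// ler_pXn2r ?nnegrE ?mulr_ge0.
Qed.

Lemma ler_L2normD f g : L2mem f -> L2mem g ->
  L2norm (fun x => f x + g x) <= L2norm f + L2norm g.
Proof.
move=> Lf Lg; rewrite -(@ler_pXn2r _ 2)// ?nnegrE ?addr_ge0 ?L2norm_ge0//.
rewrite L2norm_sqrD// sqrrD lerD2r lerD2l.
rewrite -(mulr_natl (_ * _)) ler_pM2l//.
by rewrite (le_trans (ler_norm _))// cauchy_schwarz_ip.
Qed.

Lemma L2norm_le_dist f g : L2mem f -> L2mem g ->
  L2norm f <= L2norm (fun x => f x - g x) + L2norm g.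
Proof.
move=> Lf Lg; have := ler_L2normD (L2memB Lf Lg) Lg.
by rewrite (_ : (fun x => _ - _ + _) = f)//; apply/funext => x; rewrite subrK.
Qed.

Lemma L2norm_dist f g : L2mem f -> L2mem g ->
  `|L2norm f - L2norm g| <= L2norm (fun x => f x - g x).
Proof.
move=> Lf Lg; rewrite ler_norml; apply/andP; split.
  by rewrite lerBrDl lerBlDr L2norm_distC addrC L2norm_le_dist.
by rewrite lerBlDr L2norm_le_dist.
Qed.

(** The norm is 1-Lipschitz. Convergence in L^2 is spelled as a norm of differences tending to 0,
    and the filter is arbitrary because sequences, two-sided limits and the one-sided limit at 0 all
    occur. *)
Lemma cvg_L2norm (T : Type) (F : set_system T) (FF : Filter F)
    (u : T -> R -> R) f : L2mem f -> (\forall s \near F, L2mem (u s)) ->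
  (fun s => L2norm (fun x => u s x - f x)) @ F --> (0 : R) ->
  (fun s => L2norm (u s)) @ F --> L2norm f.
Proof.
move=> Lf Lu u0; apply/cvgrPdist_le => e e0.
move/cvgrPdist_le : u0 => /(_ e e0); apply: filterS2 Lu => s Lus /=.
rewrite sub0r normrN => He; rewrite distrC (le_trans (L2norm_dist Lus Lf))//.
by rewrite (le_trans (ler_norm _) He).
Qed.

Lemma cvg_ip (T : Type) (F : set_system T) (FF : Filter F)
    (u : T -> R -> R) f g : L2mem f -> L2mem g ->
  (\forall s \near F, L2mem (u s)) ->
  (fun s => L2norm (fun x => u s x - f x)) @ F --> (0 : R) ->
  (fun s => ip (u s) g) @ F --> ip f g.
Proof.
move=> Lf Lg Lu u0; apply/cvgrPdist_le => e e0.
have e'0 : 0 < e / (L2norm g + 1) by rewrite divr_gt0// ltr_wpDl ?L2norm_ge0.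
move/cvgrPdist_le : u0 => /(_ _ e'0); apply: filterS2 Lu => s Lus /=.
rewrite sub0r normrN => He; rewrite distrC -ipBl//.
rewrite (le_trans (cauchy_schwarz_ip (L2memB Lus Lf) Lg))//.
rewrite (le_trans (ler_wpM2r (L2norm_ge0 _) (le_trans (ler_norm _) He)))//.
rewrite -mulrA ger_pMr// mulrC ler_pdivrMr ?ltr_wpDl ?L2norm_ge0//.
by rewrite mul1r lerDl.
Qed.

(** The interval has length one, so the constant [k] has norm [k]. This serves to bound the reaction
    term of the heat equation. *)
Lemma L2norm_le_ae f k : L2mem f -> 0 <= k ->
  {ae mu, forall x, 0 <= x <= 1 -> `|f x| <= k} -> L2norm f <= k.
Proof.
move=> Lf k0 fk.
rewrite -(@ler_pXn2r _ 2)// ?nnegrE ?L2norm_ge0// L2norm_sqr.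
rewrite -lee_fin /ip /Rintegral fineK; last first.
  by apply: integrable_fin_num => //; exact: L2mem_integrableM.
have -> : (k ^+ 2)%:E = (\int[mu]_(x in I01) (cst (k ^+ 2)%:E) x)%E.
  by rewrite integral_cst//= lebesgue_measure_itv/= lte01 oppr0 adde0 mule1.
apply: ae_ge0_le_integral => //.
- by move=> x _; rewrite lee_fin -expr2 sqr_ge0.
- by apply/measurable_EFinP; apply: measurable_funM; exact: Lf.1.
- by move=> x _; rewrite lee_fin sqr_ge0.
apply: filterS fk => x fk; rewrite /= in_itv/= => /fk H.
by rewrite lee_fin -expr2 -real_normK ?num_real// lerXn2r// nnegrE.
Qed.

End L2_inner_product.

(** * Wirtinger's inequality and integration by parts in H_0^1 *)

Section wirtinger.
Context {R : realType}.
Local Notation mu := (@lebesgue_measure R).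
Local Notation I01 := (`[0%R, 1%R]%classic : set R).
Implicit Types f g phi : R -> R.

Let mI : measurable (I01 : set (measurableTypeR R)).
Proof. exact: measurable_itv. Qed.

Lemma continuous_L2mem f : continuous f -> L2mem f.
Proof.
move=> cf; split.
  by apply: subspace_continuous_measurable_fun => //; exact: continuous_subspaceT.
apply: (@continuous_compact_integrable R (fun x => f x ^+ 2)).
  exact: segment_compact.
apply: continuous_subspaceT => x; rewrite /continuous_at.
under eq_fun do rewrite expr2.
by apply: cvgM; exact: cf.
Qed.

Lemma derivable_continuous f : (forall x, derivable f x 1) -> continuous f.
Proof. by move=> df x; apply/differentiable_continuous/derivable1_diffP. Qed.

Lemma testfun_L2mem phi : testfun phi -> L2mem phi.
Proof. by move=> [dphi _]; exact/continuous_L2mem/derivable_continuous. Qed.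

Lemma testfun_derive1_L2mem phi : testfun phi -> L2mem (derive1 phi).
Proof. by move=> [_ [cphi _]]; exact/continuous_L2mem. Qed.

(* The vector field [pi cot(pi x) phi(x)^2] calibrates the inequality:
   [phi'^2 - pi^2 phi^2] minus its derivative is the square
   [(phi' - pi cot(pi x) phi)^2]. *)
Let cot_field phi x : R := pi * (cos (pi * x) * (sin (pi * x))^-1 * phi x ^+ 2).

Let cot_field' phi x : R :=
  2 * pi * (cos (pi * x) * (sin (pi * x))^-1) * phi x * derive1 phi x
  - pi / sin (pi * x) * (pi / sin (pi * x)) * (phi x * phi x).

Lemma sin_pi_gt0 (x : R) : 0 < x < 1 -> 0 < sin (pi * x).
Proof.
move=> /andP[x0 x1]; apply: sin_gt0_pi; rewrite mulr_gt0 ?pi_gt0//=.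
by rewrite gtr_pMr// pi_gt0.
Qed.

Let is_derive_cot_field phi x : derivable phi x 1 -> 0 < x < 1 ->
  is_derive x 1 (cot_field phi) (cot_field' phi x).
Proof.
move=> dphi x01; have s0 := lt0r_neq0 (sin_pi_gt0 x01).
have Dphi := derivableP dphi.
have Dl : is_derive x 1 (fun t => pi * t : R) pi.
  by apply: is_derive_eq; rewrite /GRing.scale/= ?(mulr0, add0r, addr0, mulr1).
have Ds : is_derive x 1 (fun t => sin (pi * t) : R) (cos (pi * x) * pi).
  exact: (@is_derive1_comp _ sin (fun t => pi * t)).
have Dc : is_derive x 1 (fun t => cos (pi * t) : R) (- sin (pi * x) * pi).
  exact: (@is_derive1_comp _ cos (fun t => pi * t)).
have Dv := is_deriveV s0 Ds.
apply: is_derive_eq.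
rewrite /cot_field' derive1E /GRing.scale/=.
apply/eqP; rewrite -subr_eq0; apply/eqP.
transitivity (pi ^+ 2 * phi x ^+ 2 / sin (pi * x) ^+ 2 *
    (1 - (cos (pi * x) ^+ 2 + sin (pi * x) ^+ 2)) : R).
  by field.
by rewrite cos2Dsin2 subrr mulr0.
Qed.

Let continuous_cot_field' phi (x : R) : testfun phi -> 0 < x < 1 ->
  cot_field' phi t @[t --> x] --> cot_field' phi x.
Proof.
move=> [dphi [cphi' _]] x01; have s0 := lt0r_neq0 (sin_pi_gt0 x01).
have cphi := derivable_continuous dphi.
have cl : (pi * t : R) @[t --> x] --> pi * x by apply: cvgM => //; exact: cvg_cst.
have cs : (sin (pi * t) : R) @[t --> x] --> sin (pi * x).
  by apply: (cvg_comp _ _ cl); exact: continuous_sin.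
have cc : (cos (pi * t) : R) @[t --> x] --> cos (pi * x).
  by apply: (cvg_comp _ _ cl); exact: continuous_cos.
have csV : ((sin (pi * t))^-1 : R) @[t --> x] --> (sin (pi * x))^-1.
  exact: cvgV.
have ct : (cos (pi * t) / sin (pi * t) : R) @[t --> x] -->
  cos (pi * x) / sin (pi * x) by exact: cvgM.
have cpV : (pi / sin (pi * t) : R) @[t --> x] --> pi / sin (pi * x).
  by apply: cvgM => //; exact: cvg_cst.
apply: cvgB.
  apply: cvgM; last exact: cphi'.
  apply: cvgM; last exact: cphi.
  by apply: cvgM => //; exact: cvg_cst.
apply: cvgM; first exact: cvgM.
by apply: cvgM; exact: cphi.
Qed.

(** The calibration is integrated over a segment inside ]0, 1[, away from the poles of the
    cotangent, whose ends lie outside the support of [phi]; the total derivative then contributes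
    nothing. *)
Lemma wirtinger_testfun phi : testfun phi ->
  pi ^+ 2 * ip phi phi <= ip (derive1 phi) (derive1 phi).
Proof.
move=> tphi; have [dphi [cphi' [a [b [a0 [b1 phi0]]]]]] := tphi.
have cphi := derivable_continuous dphi.
(* These satisfy [0 < al < a] and [b < be < 1]. The minimum with 1/2 ensures [al < be], since [a]
   and [b] come in no known order. *)
pose al := minr a (1/2) / 2; pose be := 1 - minr (1 - b) (1/2) / 2.
have al0 : 0 < al by rewrite divr_gt0// lt_min a0 divr_gt0.
have ala : al < a.
  have : minr a (1/2) <= a by rewrite ge_min lexx.
  by rewrite /al; lra.
have al1 : al <= 1/4.
  have : minr a (1/2) <= 1/2 by rewrite ge_min lexx orbT.
  by rewrite /al; lra.
have be1 : be < 1 by rewrite /be ltrBlDr ltrDl divr_gt0// lt_min subr_gt0 b1 divr_gt0.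
have bbe : b < be.
  have : minr (1 - b) (1/2) <= 1 - b by rewrite ge_min lexx.
  by rewrite /be; lra.
have be0 : 3/4 <= be.
  have : minr (1 - b) (1/2) <= 1/2 by rewrite ge_min lexx orbT.
  by rewrite /be; lra.
have albe : al < be by lra.
have sub x : x \in `[al, be] -> 0 < x < 1.
  by rewrite in_itv/= => /andP[? ?]; apply/andP; split; lra.
have subI : `[al, be]%classic `<=` I01.
  by move=> x /sub /andP[x0 x1] /=; rewrite in_itv/= !ltW.
have cg : {within `[al, be], continuous (cot_field' phi)}.
  apply: continuous_in_subspaceT => x; rewrite inE => /sub x01.
  exact: continuous_cot_field'.
have dG x : x \in `[al, be] -> derivable (cot_field phi) x 1.
  by move=> /sub x01; have [] := is_derive_cot_field (dphi x) x01.
have ccf x : x \in `[al, be] -> {for x, continuous (cot_field phi)}.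
  by move=> /dG d; apply/differentiable_continuous/derivable1_diffP.
have ig : mu.-integrable `[al, be] (EFin \o cot_field' phi).
  by apply: continuous_compact_integrable => //; exact: segment_compact.
have intg : \int[mu]_(x in I01) ((cot_field' phi \_ `[al, be]) x) = 0.
  rewrite -Rintegral_mkcondr setIidr// /Rintegral.
  rewrite (@continuous_FTC2 _ _ (cot_field phi))//.
  - rewrite /cot_field phi0; last by right.
    by rewrite phi0; [rewrite expr0n/= !mulr0 subrr|left].
  - split.
    + move=> x xab; apply: dG.
      exact: subset_itv_oo_cc xab.
    + by apply: cvg_at_right_filter; apply: ccf; rewrite in_itv/= lexx ltW.
    + by apply: cvg_at_left_filter; apply: ccf; rewrite in_itv/= lexx ltW.
  - move=> x xab; rewrite derive1E.
    have x01 : 0 < x < 1 by apply: sub; exact: subset_itv_oo_cc xab.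
    by have [_ ->] := is_derive_cot_field (dphi x) x01.
have Lphi := testfun_L2mem tphi; have Lphi' := testfun_derive1_L2mem tphi.
have iphi := L2mem_integrableM Lphi Lphi.
have iphi' := L2mem_integrableM Lphi' Lphi'.
have ipi : mu.-integrable I01 (EFin \o (fun x => pi ^+ 2 * (phi x * phi x))).
  by have := integrableZl mI (pi ^+ 2) iphi; apply: eq_integrable.
rewrite -subr_ge0 -RintegralZl// -RintegralB// -[leLHS]intg.
apply: le_Rintegral => //.
- have := (@integrable_restrict _ _ _ mu `[al, be] _ I01 mI (EFin \o cot_field' phi)).1.
  rewrite setIidr// => /(_ ltac:(exact: measurable_itv) ig).
  by rewrite restrict_EFin.
- exact: (integrableB mI iphi' ipi).
(* Outside the segment [phi] vanishes and only [phi'^2 >= 0] is left; inside, the difference is the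
   calibrating square. *)
move=> x _; rewrite patchE; case: ifPn => xab; last first.
  rewrite subr_ge0 phi0 ?mulr0 -?expr2 ?sqr_ge0//.
  have [xa|ax] := ltP x a; [by left|right].
  rewrite ltNge; apply/negP => xb; move/negP : xab; apply.
  by rewrite inE/= in_itv/= (ltW (lt_le_trans ala ax)) (ltW (le_lt_trans xb bbe)).
have /sin_pi_gt0/lt0r_neq0 s0 : 0 < x < 1 by apply: sub; rewrite inE in xab.
rewrite -subr_ge0.
set ct := cos (pi * x) / sin (pi * x) : R.
have ct2 : (pi / sin (pi * x)) ^+ 2 = pi ^+ 2 * (1 + ct ^+ 2) :> R.
  rewrite -[X in _ * (X + _)](divff (expf_neq0 2 s0)) expr_div_n.
  by rewrite /ct expr_div_n -mulrDl addrC cos2Dsin2; field.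
rewrite (_ : _ - _ = (derive1 phi x - pi * ct * phi x) ^+ 2) ?sqr_ge0//.
by rewrite /cot_field' -/ct -(expr2 (pi / _)) ct2; ring.
Qed.

Lemma wirtinger f f1 : L2mem f -> L2mem f1 -> H01approx f f1 ->
  pi * L2norm f <= L2norm f1.
Proof.
move=> Lf Lf1 [phi [tphi [phif phif1]]].
have c1 : (fun n => pi * L2norm (phi n)) @ \oo --> pi * L2norm f.
  apply: cvgM; first exact: cvg_cst.
  by apply: cvg_L2norm => //; apply: nearW => n; exact: testfun_L2mem.
have c2 : (fun n => L2norm (derive1 (phi n))) @ \oo --> L2norm f1.
  by apply: cvg_L2norm => //; apply: nearW => n; exact: testfun_derive1_L2mem.
apply: (ler_cvg_to c1 c2); apply: nearW => n.
rewrite -(@ler_pXn2r _ 2)// ?nnegrE ?mulr_ge0 ?L2norm_ge0 ?pi_ge0//.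
by rewrite exprMn !L2norm_sqr wirtinger_testfun.
Qed.

(** The approximants of [f] are test functions, hence admissible in the weak derivative of [f1].
    Membership in H_0^1 is thus what removes the boundary terms in the limit. *)
Lemma ip_weak_laplacian f f1 f2 : inH2H01 f f1 f2 ->
  ip f f2 = - L2norm f1 ^+ 2.
Proof.
move=> [Lf [Lf1 [Lf2 [_ [wf12 [phi [tphi [phif phif1]]]]]]]].
have c1 : (fun n => ip (phi n) f2) @ \oo --> ip f f2.
  by apply: cvg_ip => //; apply: nearW => n; exact: testfun_L2mem.
have c2 : (fun n => ip (derive1 (phi n)) f1) @ \oo --> ip f1 f1.
  by apply: cvg_ip => //; apply: nearW => n; exact: testfun_derive1_L2mem.
have e n : ip (derive1 (phi n)) f1 = - ip (phi n) f2.
  by rewrite ipC (ipC (phi n)) /ip /Rintegral wf12// fineN.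
rewrite L2norm_sqr -[LHS]opprK; congr (- _).
suff /cvg_unique : (fun n => ip (derive1 (phi n)) f1) @ \oo --> - ip f f2.
  by move=> /(_ (@Rhausdorff R) _ c2) ->.
by under eq_fun do rewrite e; exact: cvgN.
Qed.

End wirtinger.

(** * Absolutely continuous functions on a segment *)

Section absolute_continuity.
Context {R : realType}.
Local Notation mu := (@lebesgue_measure R).
Implicit Types (f g : R -> R) (s t : R) (U : set R).

(* Cousin's lemma, phrased as an induction along the segment: [Q] is carried
   from [u] to [v] across every point [x] by the gauge [r]. *)
Lemma segment_induction s t (Q : R -> Prop) : s <= t -> Q s ->
  (forall x, s <= x -> x <= t -> exists2 r, 0 < r & forall u v,
    s <= u -> u <= x -> x <= v -> v <= t -> x - r < u -> v < x + r ->
    Q u -> Q v) -> Q t.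
Proof.
move=> st Qs step.
pose E := [set x | [/\ s <= x, x <= t & Q x]].
have hE : has_sup E.
  by split; [exists s; split|exists t => x []].
have sE : E s by split.
have sc : s <= sup E by exact: sup_upper_bound.
have ct : sup E <= t by apply: ge_sup; [exists s|move=> x []].
have [r r0 H] := step _ sc ct.
have [u [su ut Qu] cu] := sup_adherent r0 hE.
have uc : u <= sup E by apply: sup_upper_bound => //; split.
(* The gauge at the supremum carries [Q] past it by [r / 2], which is contradictory unless [t] is
   reached first. *)
have cv : sup E <= minr t (sup E + r / 2) by rewrite le_min ct lerDl divr_ge0// ltW.
have vt : minr t (sup E + r / 2) <= t by rewrite ge_min lexx.
have vr : minr t (sup E + r / 2) < sup E + r.
  by rewrite gt_min ltrD2l gtr_pMr// invf_lt1// ltr1n orbT.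
have Qv := H _ _ su uc cv vt cu vr Qu.
have [|tv] := leP t (sup E + r / 2); first by move=> /min_idPl <-.
have : minr t (sup E + r / 2) <= sup E.
  by apply: sup_upper_bound => //; split => //; exact: le_trans cv.
rewrite (min_idPr _); last exact: ltW.
by rewrite gerDl pmulr_lle0// leNgt r0.
Qed.

Lemma abs_cont_onW f a b s t : a <= s -> t <= b ->
  abs_cont_on f a b -> abs_cont_on f s t.
Proof.
move=> as_ tb acf e /acf[dl dl0 H]; exists dl => // n u v uv; apply: H => i.
by have [? [? ?]] := uv i; split; [exact: le_trans as_ _|split => //; exact: le_trans tb].
Qed.

Lemma abs_cont_on_dist f a b e : abs_cont_on f a b -> 0 < e ->
  exists2 dl, 0 < dl & forall s t, a <= s -> s <= t -> t <= b -> t - s < dl ->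
    `|f t - f s| < e.
Proof.
move=> acf /acf[dl dl0 H]; exists dl => // s t as_ st tb ts.
have := H 1%N (fun=> s) (fun=> t); rewrite !big_ord1; apply => //.
by move=> i j; rewrite !ord1.
Qed.

(** The oscillation near each point is at most 1 with a uniform gauge, so a bound on an initial
    segment extends across every point. *)
Lemma abs_cont_on_bounded f a b : a <= b -> abs_cont_on f a b ->
  exists2 M, 0 <= M & forall x, a <= x <= b -> `|f x| <= M.
Proof.
move=> ab acf; have [dl dl0 H] := abs_cont_on_dist acf ltr01.
apply: (@segment_induction a b
  (fun x => exists2 M, 0 <= M & forall y, a <= y <= x -> `|f y| <= M)) => //.
  exists `|f a| => // x /andP[ax xa].
  by have -> : x = a by apply/eqP; rewrite eq_le ax xa.
move=> x ax xb; exists (dl / 2); first by rewrite divr_gt0.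
move=> u v au ux xv vb xu vx [M M0 fM].
exists (maxr M (`|f x| + 1)); first by rewrite le_max M0.
move=> y /andP[ay yv]; rewrite le_max.
have [yu|uy] := leP y u; first by rewrite fM ?ay.
apply/orP; right; rewrite -lerBlDl.
have [yx|xy] := leP y x.
  have := H y x ay yx xb ltac:(lra); rewrite distrC => /ltW.
  by apply: le_trans; exact: lerB_dist.
have := H x y ax (ltW xy) (le_trans yv vb) ltac:(lra) => /ltW.
by apply: le_trans; exact: lerB_dist.
Qed.

Lemma lipschitz_abs_cont_on f s t M : 0 <= M ->
  (forall u v, s <= u -> u <= v -> v <= t -> `|f v - f u| <= M * (v - u)) ->
  abs_cont_on f s t.
Proof.
move=> M0 Lf e e0; exists (e / (M + 1)); first by rewrite divr_gt0// ltr_wpDl.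
move=> n u v uv _ /=; rewrite ltr_pdivlMr ?ltr_wpDl// => H.
have d0 : 0 <= \sum_(i < n) (v i - u i).
  by apply: sumr_ge0 => i _; have [_ [? _]] := uv i; rewrite subr_ge0.
apply: le_lt_trans H.
apply: (@le_trans _ _ (\sum_(i < n) M * (v i - u i))).
  by apply: ler_sum => i _; have [? [? ?]] := uv i; exact: Lf.
by rewrite -mulr_sumr mulrC ler_wpM2l// lerDl.
Qed.

Lemma abs_cont_onD f g s t : abs_cont_on f s t -> abs_cont_on g s t ->
  abs_cont_on (fun x => f x + g x) s t.
Proof.
move=> acf acg e e0; have e20 : 0 < e / 2 by rewrite divr_gt0.
have [d1 d10 H1] := acf _ e20; have [d2 d20 H2] := acg _ e20.
exists (minr d1 d2); first by rewrite lt_min d10.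
move=> n u v uv dis; rewrite lt_min => /andP[lt1 lt2].
have := ltrD (H1 n u v uv dis lt1) (H2 n u v uv dis lt2).
rewrite -splitr -big_split/=; apply: le_lt_trans; apply: ler_sum => i _.
by rewrite opprD addrACA ler_normD.
Qed.

Lemma abs_cont_onM f g s t : s <= t -> abs_cont_on f s t -> abs_cont_on g s t ->
  abs_cont_on (fun x => f x * g x) s t.
Proof.
move=> st acf acg e e0.
have [M1 M10 fM] := abs_cont_on_bounded st acf.
have [M2 M20 gM] := abs_cont_on_bounded st acg.
have p1 : 0 < e / 2 / (M2 + 1) by rewrite !divr_gt0// ltr_wpDl.
have p2 : 0 < e / 2 / (M1 + 1) by rewrite !divr_gt0// ltr_wpDl.
have [d1 d10 H1] := acf _ p1; have [d2 d20 H2] := acg _ p2.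
exists (minr d1 d2); first by rewrite lt_min d10.
move=> n u v uv dis; rewrite lt_min => /andP[lt1 lt2].
have I1 := H1 n u v uv dis lt1; rewrite ltr_pdivlMr ?ltr_wpDl// in I1.
have I2 := H2 n u v uv dis lt2; rewrite ltr_pdivlMr ?ltr_wpDl// in I2.
rewrite (splitr e); have := ltrD I1 I2; apply: le_lt_trans.
rewrite !mulr_suml -big_split/=; apply: ler_sum => i _.
have [su [uv' vt]] := uv i.
have -> : f (v i) * g (v i) - f (u i) * g (u i) =
  (f (v i) - f (u i)) * g (v i) + (g (v i) - g (u i)) * f (u i) by ring.
rewrite (le_trans (ler_normD _ _))// !normrM lerD// ler_wpM2l//.
- by rewrite (@le_trans _ _ M2)// ?lerDl// gM// (le_trans su).
- by rewrite (@le_trans _ _ M1)// ?lerDl// fM// su (le_trans uv').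
Qed.

Lemma bounded_derive1_abs_cont_on f s t M : 0 <= M ->
  (forall x, s <= x <= t -> derivable f x 1 /\ `|derive1 f x| <= M) ->
  abs_cont_on f s t.
Proof.
move=> M0 df; apply: (lipschitz_abs_cont_on M0) => u v su uv vt.
have sub x : x \in `[u, v] -> s <= x <= t.
  by rewrite in_itv/= => /andP[ux xv]; rewrite (le_trans su ux) (le_trans xv vt).
have [c /sub /df[_ cM] ->] : exists2 c, c \in `[u, v] &
    f v - f u = derive1 f c * (v - u).
  apply: MVT_segment => //.
    move=> x xuv; rewrite derive1E; apply: derivableP.
    by have [] := df x (sub x (subset_itv_oo_cc xuv)).
  by apply: derivable_within_continuous => x /sub /df [].
by rewrite normrM [X in _ * X]ger0_norm ?subr_ge0// ler_wpM2r ?subr_ge0.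
Qed.

(** By outer regularity, the exceptional null set gets an open neighbourhood of small measure, and
    openness provides the gauge at its points in [segment_induction]. *)
Lemma ae_open_cover (P : R -> Prop) (e : R) : {ae mu, forall x, P x} -> 0 < e ->
  exists U, [/\ open U, (forall x, ~ P x -> U x) & (mu U < e%:E)%E].
Proof.
move=> [A [mA A0 PA]] e0.
have Aoo : (mu A < +oo)%E by rewrite [mu A]A0.
have [U [oU AU UA]] := lebesgue_regularity_outer mA Aoo e0.
exists U; split => //; first by move=> x Px; apply: AU; apply: PA.
have mU : measurable (U : set (measurableTypeR R)) by exact: open_measurable.
rewrite -(setDUK AU) measureU//.
- by rewrite [X in (X + _)%E]A0 add0e.
- exact: measurableD.
- by rewrite setDIK.
Qed.

End absolute_continuity.

(** * Monotonicity and Gronwall's lemma from almost everywhere derivatives *)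

Section absolutely_continuous_monotonicity.
Context {R : realType}.
Local Notation mu := (@lebesgue_measure R).
Implicit Types (f g : R -> R) (s t x : R) (U : set R) (l : seq (R * R)).

(* [l] lists, from right to left, non-overlapping intervals of [s, x] that lie
   in [U]. *)
Fixpoint chain U s x l : Prop :=
  if l is (u, v) :: l' then
    [/\ u <= v, v <= x, `]u, v]%classic `<=` U & chain U s u l']
  else s <= x.

Lemma chain_ge U s x l : chain U s x l -> s <= x.
Proof.
elim: l x => [//|[u v] l IH] x /= [uv vx _ /IH su].
exact: le_trans su (le_trans uv vx).
Qed.

Lemma chainW U s x x' l : x <= x' -> chain U s x l -> chain U s x' l.
Proof.
case: l => [|[u v] l] /= xx'; first by move=> /le_trans; exact.
by move=> [uv vx subU c]; split => //; exact: le_trans xx'.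
Qed.

Lemma chain_nth U s x l i : chain U s x l -> (i < size l)%N ->
  [/\ s <= (nth (0, 0) l i).1, (nth (0, 0) l i).1 <= (nth (0, 0) l i).2 &
      (nth (0, 0) l i).2 <= x].
Proof.
elim: l x i => [//|[u v] l IH] x [|i] /= [uv vx _ c]; rewrite ltnS => il.
  by split => //; exact: chain_ge c.
have [? ? le] := IH _ _ c il; split => //.
exact: le_trans le (le_trans uv vx).
Qed.

Lemma chain_nth_disjoint U s x l i j : chain U s x l -> (i < j)%N ->
  (j < size l)%N -> (nth (0, 0) l j).2 <= (nth (0, 0) l i).1.
Proof.
elim: l x i j => [//|[u v] l IH] x [|i] [|j]//= [uv vx _ c].
  by rewrite ltnS => _ jl; have [] := chain_nth c jl.
by rewrite !ltnS => ij jl; exact: IH c ij jl.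
Qed.

(** The intervals are half-open, so adjacent ones stay disjoint. Cutting [U] down to ]s, x] lets the
    head interval split off in the induction. *)
Lemma chain_measure U s x l : open U -> chain U s x l ->
  ((\sum_(i < size l) ((nth (0, 0) l i).2 - (nth (0, 0) l i).1))%:E <=
   mu (U `&` `]s, x]))%E.
Proof.
move=> oU; have mU : measurable (U : set (measurableTypeR R)).
  exact: open_measurable.
have mi (i : interval R) : measurable ([set` i] : set (measurableTypeR R)).
  exact: measurable_itv.
elim: l x => [|[u v] l IH] x /=; first by rewrite big_ord0 => _; exact: measure_ge0.
move=> [uv vx subU c]; rewrite big_ord_recl/=.
have su := chain_ge c.
apply: (@le_trans _ _ (mu (`]u, v]%classic `|` (U `&` `]s, u]%classic)))%E); last first.
  apply: le_measure; rewrite ?inE.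
  - by apply: measurableU => //; exact: measurableI.
  - exact: measurableI.
  move=> y [yuv|[Uy]] /=; rewrite ?in_itv/=.
    split; first exact: subU.
    by move: yuv; rewrite /= !in_itv/= => /andP[uy yv];
      rewrite (le_lt_trans su uy) (le_trans yv vx).
  by move=> /andP[sy yu]; split => //; rewrite sy (le_trans yu)// (le_trans uv).
rewrite measureU//; last 2 first.
- exact: measurableI.
- apply/seteqP; split => // y [/=]; rewrite !in_itv/= => /andP[uy _] [_ /andP[_ yu]].
  by move: (lt_le_trans uy yu); rewrite ltxx.
rewrite EFinD; apply: leeD; last exact: IH.
rewrite [leRHS](lebesgue_measure_itv `]u, v])/= lte_fin.
by case: ltP => // vu; rewrite lee_fin subr_le0.
Qed.

(** Since [u] and [v] lie on opposite sides of [x], the two difference quotients at [x] itself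
    suffice; nothing is asked of the derivative nearby. *)
Lemma derive1_le0_near f x e : derivable f x 1 -> derive1 f x <= 0 -> 0 < e ->
  exists2 r, 0 < r & forall u v, u <= x -> x <= v -> x - r < u -> v < x + r ->
    f v <= f u + e * (v - u).
Proof.
move=> df f0 e0.
have : h^-1 * (f (h + x) - f x) @[h --> 0^'] --> derive1 f x.
  have := df; rewrite /derivable derive1E /derive.
  by under eq_fun do rewrite /GRing.scale/= mulr1.
move=> /cvgrPdist_le /(_ e e0); rewrite near_withinE => /nbhs_ballP[r /= r0 H].
have H' h : h != 0 -> `|h| < r -> h^-1 * (f (h + x) - f x) <= e.
  move=> h0 hr; have := H h; rewrite /ball/= sub0r normrN => /(_ hr h0).
  by rewrite distrC => /(le_trans (ler_norm _)); lra.
exists r => // u v ux xv xu vx.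
have Hv : f v <= f x + e * (v - x).
  have [->|vx0] := eqVneq v x; first by rewrite subrr mulr0 addr0.
  have v0 : 0 < v - x by rewrite subr_gt0 lt_neqAle eq_sym vx0.
  have := H' (v - x) (lt0r_neq0 v0); rewrite subrK gtr0_norm// => /(_ ltac:(lra)).
  by rewrite mulrC ler_pdivrMr//; lra.
have Hu : f x <= f u + e * (x - u).
  have [->|ux0] := eqVneq u x; first by rewrite subrr mulr0 addr0.
  have u0 : 0 < x - u by rewrite subr_gt0 lt_neqAle ux0.
  have nz : u - x != 0 by rewrite subr_eq0.
  have := H' (u - x) nz; rewrite subrK distrC gtr0_norm// => /(_ ltac:(lra)).
  rewrite -[u - x]opprB invrN mulNr -mulrN opprB mulrC ler_pdivrMr//; lra.
lra.
Qed.

(* Away from a null set the sign of the derivative controls the increments; the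
   null set is covered by an open set so small that absolute continuity makes
   the increments over it negligible. *)
Lemma abs_cont_on_nonincreasing f s t : s <= t -> abs_cont_on f s t ->
  {ae mu, forall x, s < x < t -> derivable f x 1 /\ derive1 f x <= 0} ->
  f t <= f s.
Proof.
move=> st acf aef; apply/ler_addgt0Pr => e e0.
(* The errors are [e' (t - s)] from the good points and [e'] from the cover, which add up to [e]. *)
pose e' := e / (t - s + 1).
have ts0 : 0 < t - s + 1 by rewrite ltr_wpDl// subr_ge0.
have e'0 : 0 < e' by rewrite divr_gt0.
have [dl dl0 Hac] := acf _ e'0.
have ae1 (a : R) : {ae mu, forall x, x != a}.
  exists [set a]; split; [exact: measurable_set1|exact: lebesgue_measure_set1|].
  by move=> x /= /negP; rewrite negbK => /eqP.
(* The endpoints, where no derivative is assumed, are counted among the exceptional points. *)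
have [U [oU BU Udl]] : exists U, [/\ open U, (forall x,
    ~ [/\ s < x < t -> derivable f x 1 /\ derive1 f x <= 0, x != s & x != t] ->
    U x) & (mu U < dl%:E)%E].
  by apply: ae_open_cover => //; apply: filterS3 aef (ae1 s) (ae1 t).
(* Crossing a good point costs [e'] times the step; crossing an exceptional one pushes the step,
   contained in [U], onto the chain. *)
have [l [cl Hl]] : exists l, chain U s t l /\ f t <= f s + e' * (t - s) +
    \sum_(i < size l) `|f (nth (0, 0) l i).2 - f (nth (0, 0) l i).1|.
  apply: (@segment_induction R s t (fun x => exists l, chain U s x l /\
    f x <= f s + e' * (x - s) +
    \sum_(i < size l) `|f (nth (0, 0) l i).2 - f (nth (0, 0) l i).1|)) => //.
    by exists [::]; split; rewrite /= ?big_ord0 ?subrr ?mulr0 ?addr0 ?lexx.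
  move=> x sx xt.
  have [[gx xs xt']|/BU Ux] := pselect
      [/\ s < x < t -> derivable f x 1 /\ derive1 f x <= 0, x != s & x != t].
    have [|df f0] := gx; first by rewrite !lt_neqAle eq_sym xs sx xt' xt.
    have [r r0 H] := derive1_le0_near df f0 e'0.
    exists r => // u v su ux xv vt xu vx [l [cl Hl]].
    exists l; split; first by apply: chainW cl; exact: le_trans xv.
    by have := H u v ux xv xu vx; lra.
  have /nbhs_ballP[r /= r0 HU] : nbhs x U by exact: open_nbhs_nbhs.
  exists r => // u v su ux xv vt xu vx [l [cl Hl]].
  have uv := le_trans ux xv.
  exists ((u, v) :: l); split.
    split => // y /=; rewrite in_itv/= => /andP[uy yv]; apply: HU.
    by rewrite /ball/= ltr_norml; apply/andP; split; lra.
  rewrite big_ord_recl/=.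
  have : f v - f u <= `|f v - f u| by exact: ler_norm.
  have : 0 <= e' * (v - u) by rewrite mulr_ge0 ?subr_ge0 ?(ltW e'0).
  lra.
have small : \sum_(i < size l) ((nth (0, 0) l i).2 - (nth (0, 0) l i).1) < dl.
  rewrite -lte_fin; apply: le_lt_trans Udl.
  rewrite (le_trans (chain_measure oU cl))//; apply: le_measure; rewrite ?inE//.
  - by apply: measurableI; [exact: open_measurable|exact: measurable_itv].
  - exact: open_measurable.
have := Hac _ (fun i : 'I_(size l) => (nth (0, 0) l i).1)
  (fun i : 'I_(size l) => (nth (0, 0) l i).2) _ _ small.
move=> /(_ _ _)/wrap[].
  by move=> i; have [? ? ?] := chain_nth cl (ltn_ord i).
  move=> i j ij; have [||/ord_inj/eqP] := ltngtP i j; last by rewrite (negbTE ij).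
  - by move=> {}ij; right; exact: chain_nth_disjoint cl ij (ltn_ord j).
  - by move=> {}ij; left; exact: chain_nth_disjoint cl ij (ltn_ord i).
have ee : e' * (t - s + 1) = e by rewrite /e' divfK// lt0r_neq0.
lra.
Qed.

(** With the integrating factor, [exp(k x) (f x - C / k)] has nonpositive derivative almost
    everywhere. *)
Lemma abs_cont_on_gronwall f k C s t : 0 < k -> s <= t -> abs_cont_on f s t ->
  {ae mu, forall x, s < x < t ->
    derivable f x 1 /\ derive1 f x <= - k * f x + C} ->
  f t <= expR (- k * (t - s)) * (f s - C / k) + C / k.
Proof.
move=> k0 st acf aef.
pose E x := expR (k * x).
have dE x : is_derive x 1 E (k * E x).
  have Dl : is_derive x 1 (fun t => k * t) k.
    by apply: is_derive_eq; rewrite /GRing.scale/= ?(mulr0, add0r, addr0, mulr1).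
  rewrite mulrC; exact: (@is_derive1_comp _ expR (fun t => k * t)).
have acE : abs_cont_on E s t.
  apply: (@bounded_derive1_abs_cont_on _ _ _ _ (k * E t)).
    by rewrite mulr_ge0 ?expR_ge0 ?ltW.
  move=> x /andP[sx xt]; split; first by have [] := dE x.
  rewrite derive1E; have [_ ->] := dE x.
  rewrite normrM !gtr0_norm ?expR_gt0// ler_wpM2l ?(ltW k0)//.
  by rewrite ler_expR ler_wpM2l ?(ltW k0).
have acc : abs_cont_on (cst (- (C / k))) s t.
  apply: (@lipschitz_abs_cont_on _ _ _ _ 0) => // u v _ _ _.
  by rewrite subrr normr0 mul0r.
have acF : abs_cont_on (fun x => E x * (f x + cst (- (C / k)) x)) s t.
  by apply: abs_cont_onM => //; exact: abs_cont_onD.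
have : E t * (f t - C / k) <= E s * (f s - C / k).
  apply: (abs_cont_on_nonincreasing st acF).
  apply: filterS aef => x H /H[df f'] {H}.
  have Df := derivableP df.
  have DF : is_derive x 1 (fun x => E x * (f x + cst (- (C / k)) x))
      (E x * derive1 f x + (f x - C / k) * (k * E x)).
    by apply: is_derive_eq; rewrite derive1E /GRing.scale/= subr0.
  split; first by case: DF.
  rewrite derive1E; case: DF => _ ->.
  have -> : E x * derive1 f x + (f x - C / k) * (k * E x) =
    E x * (derive1 f x - (- k * f x + C)) by field; rewrite lt0r_neq0.
  by rewrite pmulr_rle0 ?expR_gt0// subr_le0.
have -> : expR (- k * (t - s)) = E s / E t.
  by rewrite /E -expRN -expRD; congr expR; ring.
rewrite -mulrA (mulrC (E t)^-1) mulrA -lerBlDr ler_pdivlMr ?expR_gt0//.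
by rewrite mulrC.
Qed.

End absolutely_continuous_monotonicity.

(** * Young-type inequalities for the energy and the output *)

Section scalar_estimates.
Context {R : realType}.
Implicit Types p P a b c q r n Y D T tau : R.

Lemma young2 (x y k : R) : 0 < k -> 2 * x * y <= k * x ^+ 2 + y ^+ 2 / k.
Proof.
move=> k0; rewrite -subr_ge0.
rewrite (_ : _ - _ = (k * x - y) ^+ 2 / k); last by field; rewrite lt0r_neq0.
by rewrite divr_ge0 ?sqr_ge0 ?ltW.
Qed.

(** Here [n] is the norm of w, [Y] is |y|, [tau] is |theta_1| + |theta_2| and [q] is the adaptive
    part of the gain. The coupling costs [P n^2], [2 Y^4] and a constant; the quartic part of the
    controller pays for [2 Y^4], and [2 q Y^2] absorbs the disturbance. *)
Lemma energy_estimate P a b c q n Y D T tau (k : R) :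
  0 < P -> 0 < b -> 0 < q -> 1 <= c -> b <= 4 * a * q ->
  tau ^+ 2 <= 2 * T ^+ 2 -> k <= P -> k <= 2 * c ->
  - 2 * P * n ^+ 2 + 2 * tau * n * Y
    - 2 * (c * (1 + q) * (Y ^+ 8 + Y ^+ 4 + Y ^+ 2)) + 2 * D * Y
  <= - k * (n ^+ 2 + Y ^+ 2) + (2 * a * D ^+ 2 / b + T ^+ 4 / (2 * P ^+ 2)).
Proof.
move=> P0 b0 q0 c1 bq tauT kP kc.
have PV : 0 < P^-1 by rewrite invr_gt0.
have h1 := young2 n (tau * Y) P0.
have h2 : (tau * Y) ^+ 2 / P <= 2 * T ^+ 2 * Y ^+ 2 / P.
  by rewrite ler_pM2r// exprMn ler_wpM2r// sqr_ge0.
have h3 : 2 * T ^+ 2 * Y ^+ 2 / P <= 2 * Y ^+ 4 + T ^+ 4 / (2 * P ^+ 2).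
  rewrite -subr_ge0 (_ : _ - _ = 2 * (Y ^+ 2 - T ^+ 2 / (2 * P)) ^+ 2); last first.
    by field; rewrite lt0r_neq0.
  by rewrite mulr_ge0// sqr_ge0.
have h4 := @young2 Y D (2 * q) ltac:(lra).
have h5 : D ^+ 2 / (2 * q) <= 2 * a * D ^+ 2 / b.
  rewrite ler_pdivrMr ?mulr_gt0// mulrAC ler_pdivlMr//.
  by have := ler_wpM2l (sqr_ge0 D) bq; lra.
have Y2 := sqr_ge0 Y; have Y4 : 0 <= Y ^+ 4 by rewrite exprn_even_ge0.
have Y8 : 0 <= Y ^+ 8 by rewrite exprn_even_ge0.
have cq : 1 <= c * (1 + q) by nra.
have h6 := ler_peMl Y4 cq.
have h7 : 0 <= c * (1 + q) * Y ^+ 8 by rewrite mulr_ge0// (le_trans ler01).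
have h8 : c * Y ^+ 2 + q * Y ^+ 2 <= c * (1 + q) * Y ^+ 2.
  by rewrite -mulrDl ler_wpM2r//; nra.
have h9 := ler_wpM2r (sqr_ge0 n) kP; have h10 := ler_wpM2r Y2 kc.
lra.
Qed.

(** The Young weights are chosen so that every remainder carries the factor [r]. Weighting [n^2] by
    [r P / 2] leaves a quartic term with coefficient [r^-6 / 4], which [q Y^4] absorbs thanks to
    [1 <= 4 q r^6]. *)
Lemma output_estimate p P c q r n Y D T tau : 0 < p -> p <= P ->
  0 < r -> r <= 1 -> 1 <= 4 * q * r ^+ 6 -> 1 <= c -> 0 <= q ->
  tau ^+ 2 <= T ^+ 2 ->
  - (c * (1 + q) * (Y ^+ 8 + Y ^+ 4 + Y ^+ 2)) + tau * n * Y + D * Y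
  <= - c * Y ^+ 2 +
     r * (D ^+ 2 + P / 2 * n ^+ 2 + 2 / p ^+ 2 + T ^+ 8 / (2 * P ^+ 2)).
Proof.
move=> p0 pP r0 r1 qr c1 q0 tauT.
have P0 : 0 < P by exact: lt_le_trans pP.
have rP0 : 0 < r * P by rewrite mulr_gt0.
have r6 : 0 < r ^+ 6 by rewrite exprn_gt0.
have q4 : (r ^+ 6)^-1 <= 4 * q by rewrite -div1r ler_pdivrMr.
have qr1 : r^-1 <= 4 * q.
  apply: le_trans q4; rewrite lef_pV2 ?posrE// -[leRHS]expr1.
  by rewrite ler_wiXn2l// ltW.
have rV : 0 < r^-1 by rewrite invr_gt0.
have q1 : 0 < q by lra.
have Y2 := sqr_ge0 Y; have Y4 : 0 <= Y ^+ 4 by rewrite exprn_even_ge0.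
have Y8 : 0 <= Y ^+ 8 by rewrite exprn_even_ge0.
have T4 : 0 <= T ^+ 4 by rewrite exprn_even_ge0.
have h1 := young2 n (tau * Y) rP0.
have h2 : (tau * Y) ^+ 2 / (r * P) <= T ^+ 2 * Y ^+ 2 / (r * P).
  by rewrite ler_pM2r ?invr_gt0// exprMn ler_wpM2r.
have h3 : T ^+ 2 * Y ^+ 2 / (r * P) <=
    2 * ((r ^+ 6)^-1 / 4 * Y ^+ 4 + r ^+ 4 * (T ^+ 4 / (4 * P ^+ 2))).
  rewrite -subr_ge0 (_ : _ - _ =
    2 * (Y ^+ 2 / (2 * r ^+ 3) - r ^+ 2 * T ^+ 2 / (2 * P)) ^+ 2); last first.
    by field; rewrite !lt0r_neq0.
  by rewrite mulr_ge0// sqr_ge0.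
have h4 : (r ^+ 6)^-1 / 4 * Y ^+ 4 <= q * Y ^+ 4 by rewrite ler_wpM2r//; lra.
have TP0 : 0 <= T ^+ 4 / (4 * P ^+ 2).
  by rewrite divr_ge0// mulr_ge0// sqr_ge0.
have h5 : r ^+ 4 * (T ^+ 4 / (4 * P ^+ 2)) <= r * (T ^+ 4 / (4 * P ^+ 2)).
  rewrite ler_wpM2r// -[leRHS]expr1.
  by rewrite ler_wiXn2l// ltW.
(* Trading the fourth power of [T] for the eighth by [(T^4 - 1)^2 >= 0] is what produces the term
   [2 / p^2]. *)
have h6 : T ^+ 4 / (4 * P ^+ 2) <= 2 / p ^+ 2 + T ^+ 8 / (2 * P ^+ 2).
  have P2 : (P ^+ 2)^-1 <= (p ^+ 2)^-1.
    by rewrite lef_pV2 ?posrE ?exprn_gt0// ler_pXn2r// nnegrE ltW.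
  have P2' : 0 <= (P ^+ 2)^-1 by rewrite invr_ge0 sqr_ge0.
  have : (P ^+ 2)^-1 * (T ^+ 4 / 4) <= (P ^+ 2)^-1 * (2 + T ^+ 8 / 2).
    rewrite ler_wpM2l//; have := sqr_ge0 (T ^+ 4 - 1); rewrite sqrrB expr1n -exprM; lra.
  rewrite (_ : T ^+ 4 / (4 * P ^+ 2) = (P ^+ 2)^-1 * (T ^+ 4 / 4)); last first.
    by field; rewrite lt0r_neq0.
  rewrite (_ : T ^+ 8 / (2 * P ^+ 2) = (P ^+ 2)^-1 * (T ^+ 8 / 2)); last first.
    by field; rewrite lt0r_neq0.
  lra.
have h7 := ler_wpM2l (ltW r0) h6.
have h8 := @young2 Y D (2 * q) ltac:(lra).
have h9 : D ^+ 2 / (2 * q) <= 2 * (r * D ^+ 2).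
  rewrite ler_pdivrMr ?mulr_gt0//.
  have : r * r^-1 <= r * (4 * q) by rewrite ler_wpM2l// ltW.
  rewrite mulfV ?lt0r_neq0// => /(ler_wpM2l (sqr_ge0 D)); lra.
have cq : 1 <= c * (1 + q) by nra.
have h10 : q * Y ^+ 4 <= c * (1 + q) * Y ^+ 4 by rewrite ler_wpM2r//; nra.
have h11 : 0 <= c * (1 + q) * Y ^+ 8 by rewrite mulr_ge0// (le_trans ler01).
have h12 : c * Y ^+ 2 + q * Y ^+ 2 <= c * (1 + q) * Y ^+ 2.
  by rewrite -mulrDl ler_wpM2r//; nra.
lra.
Qed.

(* [Kbar] is what is needed to absorb [P / 2] times the uniform bound on
   [||w||^2 + y^2] given by the energy estimate. *)
Lemma gain_estimate p P a b k n D T W0 : 0 < p -> 0 < P -> 0 < a -> 0 < b ->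
  0 < k -> k <= P / 2 -> 0 <= W0 ->
  n ^+ 2 <= W0 + 2 * a * (D ^+ 2 + T ^+ 8 + 2 / p ^+ 2) / (b * k)
            + T ^+ 4 / (2 * P ^+ 2 * k) ->
  D ^+ 2 + P / 2 * n ^+ 2 + 2 / p ^+ 2 + T ^+ 8 / (2 * P ^+ 2) <=
  (1 + a * P / (b * k) + P / 2 + (4 * P * k)^-1) *
  (D ^+ 2 + T ^+ 4 + T ^+ 8 + 2 / p ^+ 2 + W0).
Proof.
move=> p0 P0 a0 b0 k0 kP W00 nle.
have D2 := sqr_ge0 D; have T4 : 0 <= T ^+ 4 by rewrite exprn_even_ge0.
have T8 : 0 <= T ^+ 8 by rewrite exprn_even_ge0.
have p2 : 0 <= 2 / p ^+ 2 by rewrite divr_ge0// sqr_ge0.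
set A := a * P / (b * k).
have A0 : 0 <= A by rewrite divr_ge0// mulr_ge0// ltW.
set B := (4 * P * k)^-1.
have B0 : 0 <= B by rewrite invr_ge0 !mulr_ge0// ltW.
have h1 : P / 2 * n ^+ 2 <=
    P / 2 * W0 + A * (D ^+ 2 + T ^+ 8 + 2 / p ^+ 2) + B * T ^+ 4.
  have /(ler_wpM2l (ltW (divr_gt0 P0 (ltr0Sn R 1)))) := nle.
  move=> /le_trans; apply; rewrite le_eqVlt; apply/orP; left; apply/eqP.
  by rewrite /A /B; field; rewrite !lt0r_neq0.
have h2 : T ^+ 8 / (2 * P ^+ 2) <= B * T ^+ 8.
  rewrite mulrC ler_wpM2r// lef_pV2 ?posrE ?mulr_gt0 ?exprn_gt0//.
  rewrite expr2; nra.
have h3 : 0 <= A * (T ^+ 4 + W0) by rewrite mulr_ge0// addr_ge0.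
have h4 : 0 <= P / 2 * (D ^+ 2 + T ^+ 4 + T ^+ 8 + 2 / p ^+ 2).
  by rewrite mulr_ge0 ?divr_ge0 ?(ltW P0)// !addr_ge0.
have h5 : 0 <= B * (D ^+ 2 + 2 / p ^+ 2 + W0) by rewrite mulr_ge0// !addr_ge0.
lra.
Qed.

End scalar_estimates.

(** * A scalar output driven by an adaptation with dead zone *)

Section deadzone_adaptation.
Context {R : realType}.
Local Notation mu := (@lebesgue_measure R).
Variables (v Z : R -> R) (k eps Gam A b : R).
Hypotheses (k0 : 0 < k) (eps0 : 0 < eps) (Gam0 : 0 < Gam) (A0 : 0 < A) (b1 : 1 <= b).
Hypotheses (v_ge0 : forall t, 0 <= v t) (Z_ge0 : forall t, 0 <= Z t).
Hypothesis acv : forall T, 0 <= T -> abs_cont_on v 0 T.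
Hypothesis dv : {ae mu, forall t, 0 < t ->
  derivable v t 1 /\ derive1 v t <= - k * v t + A / (b + Z t)}.
Hypothesis cZ : {within `[0, +oo[, continuous Z}.
Hypothesis dZ : forall t, 0 < t ->
  derivable Z t 1 /\ derive1 Z t = Gam * ppart (v t - eps).

Let cZ_segment s t : 0 <= s -> {within `[s, t], continuous Z}.
Proof.
move=> s0; apply: continuous_subspaceW cZ => x /=.
by rewrite !in_itv/= andbT => /andP[sx _]; exact: le_trans sx.
Qed.

Let acv_segment s t : 0 <= s -> s <= t -> abs_cont_on v s t.
Proof. by move=> s0 st; apply: abs_cont_onW (acv (le_trans s0 st)). Qed.

Lemma deadzone_nondecreasing s t : 0 <= s -> s <= t -> Z s <= Z t.
Proof.
move=> s0 st; apply: (@ger0_derive1_le_cc _ Z s t) => //.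
- move=> x; rewrite in_itv/= => /andP[sx _].
  by have [] := dZ (le_lt_trans s0 sx).
- move=> x; rewrite in_itv/= => /andP[sx _].
  have [_ ->] := dZ (le_lt_trans s0 sx).
  by rewrite mulr_ge0 ?(ltW Gam0)// /ppart le_max lexx orbT.
- exact: cZ_segment.
- by rewrite in_itv/= lexx.
- by rewrite in_itv/= st lexx.
Qed.

Let A_div t : A / (b + Z t) <= A.
Proof.
rewrite ler_pdivrMr; last by rewrite (lt_le_trans ltr01)// (le_trans b1)// lerDl.
by rewrite ler_peMr ?(ltW A0)// (le_trans b1)// lerDl.
Qed.

Let v_bounded t : 0 <= t -> v t <= v 0 + A / k.
Proof.
move=> t0.
have := @abs_cont_on_gronwall R v k A 0 t k0 t0 (acv t0).
move=> /(_ _)/wrap[|H].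
  apply: filterS dv => x H /andP[x0 _]; have [? /le_trans le] := H x0.
  by split => //; apply: le; rewrite lerD2l.
apply: (le_trans H); rewrite lerD2r.
have Ak : 0 <= A / k by rewrite divr_ge0// ltW.
have e1 : expR (- k * (t - 0)) <= 1.
  by rewrite expR_le1 subr0 mulNr oppr_le0 mulr_ge0// ltW.
have := expR_ge0 (- k * (t - 0)); have := v_ge0 0; nra.
Qed.

(** As [Z] is nondecreasing, the forcing [A / (b + Z)] stays below [k eps] from [s] on, and
    Gronwall's lemma applies with equilibrium [eps]. *)
Let v_decay s t : 0 <= s -> s <= t -> A / (k * eps) <= Z s ->
  v t - eps <= expR (- k * (t - s)) * v s.
Proof.
move=> s0 st ZA.
have := @abs_cont_on_gronwall R v k (k * eps) s t k0 st (acv_segment s0 st).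
move=> /(_ _)/wrap[|].
  apply: filterS dv => x H /andP[sx _].
  have [? /le_trans le] := H (le_lt_trans s0 sx).
  split => //; apply: le; rewrite lerD2l.
  have b0 : 0 < b + Z x by rewrite (lt_le_trans ltr01)// (le_trans b1)// lerDl.
  rewrite ler_pdivrMr// mulrC -ler_pdivrMr ?mulr_gt0//.
  rewrite (le_trans ZA)// (le_trans (deadzone_nondecreasing s0 (ltW sx)))//.
  by rewrite lerDr (le_trans ler01).
rewrite [k * eps / k]mulrAC mulfV ?lt0r_neq0// mul1r => H.
rewrite lerBlDr (le_trans H)// lerD2r ler_wpM2l ?expR_ge0//.
by rewrite gerBl ltW.
Qed.

(* Once [Z] reaches [A / (k eps)] the dead zone attracts [v] exponentially, so
   that [Z] can only grow by [Gam v / k] from then on. *)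
Lemma deadzone_bounded t : 0 <= t ->
  Z t <= Z 0 + A / (k * eps) + Gam / k * (v 0 + A / k).
Proof.
move=> t0; set m := maxr (Z 0) (A / (k * eps)).
have Ake : 0 <= A / (k * eps) by rewrite divr_ge0 ?mulr_ge0 ?ltW.
have mle : m <= Z 0 + A / (k * eps).
  by rewrite ge_max lerDl Ake lerDr Z_ge0.
have Gk : 0 <= Gam / k by rewrite divr_ge0 ?ltW.
have Ak : 0 <= A / k by rewrite divr_ge0 ?ltW.
have [Ztm|mZt] := leP (Z t) m.
  rewrite (le_trans Ztm)// (le_trans mle)// lerDl mulr_ge0// addr_ge0//.
have Z0t : Z 0 <= Z t by exact: deadzone_nondecreasing.
(* The time [s] at which [Z] meets the threshold [m], so that the decay estimate starts from a known
   value of [Z]. *)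
have [s] : exists2 s, s \in `[0, t] & Z s = m.
  apply: IVT => //; first exact: cZ_segment.
  rewrite (min_idPl Z0t) (max_idPr Z0t); apply/andP; split; last exact: ltW.
  by rewrite /m le_max lexx.
rewrite in_itv/= => /andP[s0 st] Zs.
have As : A / (k * eps) <= Z s by rewrite Zs le_max lexx orbT.
pose E (x : R) : R := expR (- k * (x - s)).
have dE (x : R) : is_derive x 1 E (- k * E x).
  have Dl : is_derive x 1 (fun x => - k * (x - s)) (- k).
    by apply: is_derive_eq; rewrite /GRing.scale/= ?(mulr0, add0r, addr0, subr0, mulr1).
  rewrite mulrC; exact: (@is_derive1_comp _ expR (fun x => - k * (x - s))).
(* The added term has derivative [- Gam v(s) E], which dominates the growth of [Z], so [F] is
   nonincreasing. *)
pose F x := Z x + Gam / k * v s * E x.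
have DF (x : R) : 0 < x -> is_derive x 1 F
    (Gam * ppart (v x - eps) - Gam * v s * E x).
  move=> x0; have [dZx Z'] := dZ x0; have DZ := derivableP dZx.
  have DE := dE x.
  apply: is_derive_eq; rewrite -derive1E Z' /GRing.scale/=.
  by field; rewrite lt0r_neq0.
have Fts : F t <= F s.
  apply: (@ler0_derive1_le_cc _ F s t) => //.
  - move=> x; rewrite in_itv/= => /andP[sx _].
    by have [] := DF _ (le_lt_trans s0 sx).
  - move=> x; rewrite in_itv/= => /andP[sx _].
    rewrite derive1E; have [_ ->] := DF _ (le_lt_trans s0 sx).
    rewrite subr_le0 -mulrA ler_wpM2l ?(ltW Gam0)// /ppart ge_max.
    rewrite mulr_ge0 ?expR_ge0// andbT mulrC; apply: v_decay => //.
    exact: ltW.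
  - move=> x; apply: cvgD; first exact: cZ_segment.
    apply: cvgM; first exact: cvg_cst.
    apply: continuous_subspaceT => {}x.
    by apply/differentiable_continuous/derivable1_diffP; have [] := dE x.
  - by rewrite in_itv/= lexx st.
  - by rewrite in_itv/= lexx st.
have Es : E s = 1 by rewrite /E subrr mulr0 expR0.
have := Fts; rewrite /F Es mulr1 Zs => H.
have : 0 <= Gam / k * v s * E t.
  exact: mulr_ge0 (mulr_ge0 Gk (v_ge0 s)) (expR_ge0 _).
have := ler_wpM2l Gk (v_bounded s0).
lra.
Qed.

(** Since [v' <= A], a late value [v t >= eps + eta] forces [v >= eps + eta / 2] during the
    preceding time [tau]. Then [Z] gains at least [g] there, although it is already within [g] of
    its supremum. *)
Lemma deadzone_attractive (eta : R) : 0 < eta ->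
  \forall t \near +oo%R, v t < eps + eta.
Proof.
move=> eta0; pose tau := eta / (2 * A).
have tau0 : 0 < tau by rewrite divr_gt0// mulr_gt0.
pose g := Gam * (eta / 2) * tau.
have g0 : 0 < g by rewrite mulr_gt0// mulr_gt0// divr_gt0.
pose E := [set Z t | t in [set t | 0 <= t]].
have hE : has_sup E.
  split; first by exists (Z 0); exists 0 => /=.
  exists (Z 0 + A / (k * eps) + Gam / k * (v 0 + A / k)) => _ [t /= t0 <-].
  exact: deadzone_bounded.
have [_ [T /= T0 <-] ET] := sup_adherent g0 hE.
exists (T + tau); split; first exact: num_real.
move=> t Tt; rewrite ltNge; apply/negP => vt.
have st : t - tau < t by rewrite ltrBlDr ltrDl.
have s0 : 0 < t - tau by rewrite subr_gt0; apply: le_lt_trans Tt; rewrite lerDr.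
have vlow x : t - tau <= x -> x <= t -> eta / 2 <= v x - eps.
  move=> sx xt; have x0 := le_trans (ltW s0) sx.
  have : v t + (- A) * t <= v x + (- A) * x.
    apply: (@abs_cont_on_nonincreasing R (fun x => v x + (- A) * x) x t) => //.
      apply: abs_cont_onD; first exact: acv_segment.
      apply: (@lipschitz_abs_cont_on _ _ _ _ A); first exact: ltW.
      move=> p q _ pq _; rewrite -mulrBr normrM normrN !ger0_norm ?subr_ge0// ltW//.
    apply: filterS dv => y H /andP[xy _].
    have [dvy v'] := H (le_lt_trans x0 xy); have Dv := derivableP dvy.
    have D : is_derive y 1 (fun x => v x + (- A) * x) (derive1 v y - A).
      apply: is_derive_eq; rewrite derive1E /GRing.scale/=.
      by rewrite ?(mulr0, add0r, addr0, subr0, mulr1).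
    split; first by case: D.
    rewrite derive1E; case: D => _ ->; rewrite subr_le0 (le_trans v')//.
    by have := A_div y; have := mulr_ge0 (ltW k0) (v_ge0 y); lra.
  have : A * (t - x) <= eta / 2.
    have -> : eta / 2 = A * tau by rewrite /tau; field; rewrite lt0r_neq0.
    by rewrite ler_pM2l//; lra.
  lra.
have [||x] := @MVT R Z (derive1 Z) (t - tau) t st.
- move=> x; rewrite in_itv/= => /andP[sx _]; rewrite derive1E; apply: derivableP.
  by have [] := dZ (lt_trans s0 sx).
- exact/cZ_segment/ltW.
rewrite in_itv/= => /andP[sx xt]; have [_ ->] := dZ (lt_trans s0 sx).
have ZT : Z T <= Z (t - tau) by apply: deadzone_nondecreasing => //; lra.
have Zt : Z t <= sup E.
  by apply: sup_upper_bound => //; exists t => //=; exact: ltW (lt_trans s0 st).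
have : g <= Gam * ppart (v x - eps) * (t - (t - tau)).
  rewrite opprB addrCA subrr addr0 ler_pM2r// ler_pM2l// /ppart le_max.
  by rewrite vlow// ltW.
lra.
Qed.

End deadzone_adaptation.

(** * Derivative of the squared norm, essential bounds and upper limits *)

Section auxiliary_limits.
Context {R : realType}.
Local Notation mu := (@lebesgue_measure R).

Lemma cvg_is_derive (f : R -> R) (t l : R) :
  (fun h => h^-1 * (f (t + h) - f t)) @ 0^' --> l -> is_derive t 1 f l.
Proof.
move=> fl; have H : (fun h : R => h^-1 *: ((f \o shift t) (h *: (1 : R)) - f t))
    @ 0^' --> l.
  rewrite (_ : (fun h => _) = (fun h => h^-1 * (f (t + h) - f t)))//.
  by apply/funext => h; rewrite /GRing.scale/= mulr1 [h + t]addrC.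
by apply: DeriveDef; [apply: cvgP H|exact: cvg_lim H].
Qed.

(** Writing [u (t + h) = u t + h Q h], the difference quotient of the squared norm is
    [2 <Q h, u t> + h ||Q h||^2]. *)
Lemma is_derive_L2norm_sqr (u : R -> R -> R) (u' : R -> R) (t : R) :
  (\forall s \near t, L2mem (u s)) -> L2mem u' ->
  (fun h => L2norm (fun x => h^-1 * (u (t + h) x - u t x) - u' x)) @ 0^' -->
    (0 : R) ->
  is_derive t 1 (fun s => L2norm (u s) ^+ 2) (2 * ip (u t) u').
Proof.
move=> Lu Lu' cu.
have Lut := nbhs_singleton Lu.
pose Q h x := h^-1 * (u (t + h) x - u t x).
have near_L : \forall h \near 0^', L2mem (u (t + h)).
  apply: cvg_within; move: Lu; rewrite -[in X in X -> _](addr0 t).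
  have : t + h @[h --> (0 : R)] --> t + 0.
    by apply: cvgD; [exact: cvg_cst|exact: cvg_id].
  by move=> H; exact: H.
have near_Q : \forall h \near 0^', L2mem (Q h).
  by apply: filterS near_L => h Lh; apply: L2memZ; exact: L2memB.
apply: cvg_is_derive.
have c1 : (fun h => 2 * ip (Q h) (u t) + h * L2norm (Q h) ^+ 2) @ 0^' -->
    2 * ip u' (u t) + 0 * L2norm u' ^+ 2.
  apply: cvgD; apply: cvgM; first exact: cvg_cst.
  - exact: cvg_ip.
  - exact/cvg_within.
  - by under eq_fun do rewrite expr2; apply: cvgM; exact: cvg_L2norm.
rewrite mul0r addr0 ipC in c1; apply: cvg_trans c1; apply: near_eq_cvg.
have h0 : \forall h \near 0^', h != 0 :> R by exact: nbhs_dnbhs_neq.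
apply: filterS3 h0 near_L near_Q => h h0 Lh LQ.
have -> : u (t + h) = (fun x => u t x + h * Q h x).
  by apply/funext => x; rewrite /Q mulrA mulfV// mul1r [RHS]addrC subrK.
rewrite L2norm_sqrD//; last exact: L2memZ.
rewrite (ipC (u t)) ipZl// L2normZ// exprMn real_normK ?num_real//.
by field.
Qed.

(** The [fine] in [Linf_norm] loses nothing: the essential supremum is below +oo by assumption, and
    nonnegative because the line has positive measure. *)
Lemma Linf_norm_ae (f : R -> R) : Linf_Rplus f ->
  {ae mu, forall t, 0 <= t -> `|f t| <= Linf_norm f}.
Proof.
move=> [_ foo].
have mu0 : (0 < mu setT)%E by rewrite -set_itvNyy lebesgue_measure_itv/= ltry.
have f0 : (0 <= ess_sup_Rplus f)%E.
  apply: ess_sup_gee => //; exists set0; split; rewrite ?measure0// => t /=; apply.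
  by case: ifP => // _; rewrite lee_fin.
have fin : ess_sup_Rplus f \is a fin_num by rewrite ge0_fin_numE.
have := ess_sup_ge mu (fun t => if (0 <= t)%R then (`|f t|)%:E else 0%E).
apply: filterS => t /= H t0; move: H; rewrite t0 -lee_fin /Linf_norm fineK//.
Qed.

Lemma limf_esup_pinfty_le (f : R -> R) (l : R) :
  (forall e, 0 < e -> \forall t \near +oo%R, f t <= l + e) ->
  (limf_esup (fun t => (f t)%:E) (pinfty_nbhs R) <= l%:E)%E.
Proof.
move=> fl; apply/lee_addgt0Pr => e e0.
apply: ge_ereal_inf; exists (ereal_sup [set (f t)%:E | t in [set t | f t <= l + e]]).
  by exists [set t | f t <= l + e] => //; exact: fl.
by apply: ge_ereal_sup => _ [t /= ft <-]; rewrite -EFinD lee_fin.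
Qed.

Lemma limf_esup_pinfty_lt (f : R -> R) (l : R) :
  (limf_esup (fun t => (f t)%:E) (pinfty_nbhs R) < l%:E)%E ->
  \forall t \near +oo%R, f t < l.
Proof.
move=> /ereal_inf_lt[_ [V /= nV <-] Vl]; apply: filterS nV => t Vt.
rewrite -lte_fin; apply: le_lt_trans Vl.
by apply: ereal_sup_ubound; exists t.
Qed.

(** At 0, [f h] is [f 0] plus [h] times a convergent quotient. The filter is the one that expresses
    a C^1 function on the closed half-line. *)
Lemma derivable_within_itvcy_continuous (f : R -> R) (l : R) :
  (forall t, 0 < t -> derivable f t 1) ->
  (fun h => h^-1 * (f (0 + h) - f 0))
    @ within (fun h : R => h != 0 /\ 0 <= 0 + h) (nbhs (0 : R)) --> l ->
  {within `[0, +oo[, continuous f}.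
Proof.
move=> df f0; apply/continuous_within_itvcyP; split.
  move=> t; rewrite in_itv/= andbT => t0.
  by apply/differentiable_continuous/derivable1_diffP/df.
have fr : (fun h => h^-1 * (f (0 + h) - f 0)) @ 0^'+ --> l.
  apply: cvg_trans f0; apply: cvg_app => A H.
  have H' : \forall h \near (0 : R), h != 0 /\ 0 <= 0 + h -> A h by exact: H.
  have H2 : \forall h \near (0 : R), 0 < h -> A h.
    by apply: filterS H' => h Hh h0; apply: Hh; rewrite add0r ltW// gt_eqF.
  exact: H2.
have cid : h @[h --> (0 : R)^'+] --> (0 : R) by apply: cvg_within; exact: cvg_id.
have H : (fun h => f 0 + h * (h^-1 * (f (0 + h) - f 0))) @ 0^'+ --> f 0 + 0 * l.
  by apply: cvgD; [exact: cvg_cst|exact: cvgM].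
rewrite mul0r addr0 in H; apply: cvg_trans H; apply: near_eq_cvg.
apply: filterS (nbhs_right_gt 0) => h h0 /=.
by rewrite add0r mulrA mulfV ?gt_eqF// mul1r addrC subrK.
Qed.

End auxiliary_limits.

(** * The closed-loop system *)

Section closed_loop.
Context {R : realType}.
Local Notation mu := (@lebesgue_measure R).
Variables (p eps Gam c a b : R) (K : R -> R -> R) (L : (R -> R) -> R).
Variables (d th1 th2 : R -> R) (w wt wx wxx : R -> R -> R) (y z : R -> R).
Hypotheses (p0 : 0 < p) (eps0 : 0 < eps) (Gam0 : 0 < Gam) (c1 : 1 <= c).
Hypotheses (b1 : 1 <= b) (a1 : a <= 1) (a0 : 0 < a).
Hypothesis KP : forall x v, 0 <= x <= 1 -> `|K x v| <= `|v|.
Hypothesis LP : forall f, H2H01 f -> `|L f| <= L2norm f.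
Hypothesis dP : Linf_Rplus d.
Hypothesis thP : Linf_Rplus (fun t => Num.sqrt (th1 t ^+ 2 + th2 t ^+ 2)).
Hypothesis Lw : forall t, 0 <= t -> L2mem (w t).
Hypothesis cw : forall t, 0 <= t ->
  (fun s => L2norm (fun x => w s x - w t x))
    @ within (fun s => 0 <= s) (nbhs t) --> (0 : R).
Hypothesis Lwt : forall t, 0 < t -> L2mem (wt t).
Hypothesis dw : forall t, 0 < t ->
  (fun h => L2norm (fun x => h^-1 * (w (t + h) x - w t x) - wt t x))
    @ 0^' --> (0 : R).
Hypothesis cwt : forall t, 0 < t ->
  (fun s => L2norm (fun x => wt s x - wt t x)) @ t --> (0 : R).
Hypothesis wH2 : forall t, 0 < t -> inH2H01 (w t) (wx t) (wxx t).
Hypothesis cz : {within `[0, +oo[, continuous z}.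
Hypothesis cy : {within `[0, +oo[, continuous y}.
Hypothesis acy : forall T, 0 <= T -> abs_cont_on y 0 T.
Hypothesis pde : forall t, 0 < t ->
  {ae mu, forall x, 0 <= x <= 1 -> wt t x = p * wxx t x + th1 t * K x (y t)}.
Hypothesis dz : forall t, 0 < t -> derivable z t 1 /\
  derive1 z t = Gam * expR (- z t) * ppart (y t ^+ 2 / 2 - eps).
Hypothesis dy : {ae mu, forall t, 0 < t -> derivable y t 1 /\
  derive1 y t = - c * (1 + (b + expR (z t)) ^+ 7 / (4 * a ^+ 6))
      * (y t ^+ 7 + y t ^+ 3 + y t) + th2 t * L (w t) + d t}.

Let P := p * pi ^+ 2.
Let D := Linf_norm d.
Let Th := Linf_norm (fun t => Num.sqrt (th1 t ^+ 2 + th2 t ^+ 2)).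
Let n t : R := L2norm (w t).
Let n2 t : R := L2norm (w t) ^+ 2.
Let q t : R := (b + expR (z t)) ^+ 7 / (4 * a ^+ 6).
Let k := minr (p * pi ^+ 2 / 2) (2 * c).

Lemma pi_sqr_ge1 : 1 <= pi ^+ 2 :> R.
Proof. by have := pi_ge2 R => h; rewrite expr2; nra. Qed.

Let pP : p <= P.
Proof. by rewrite /P ler_peMr ?(ltW p0)// pi_sqr_ge1. Qed.

Let P0 : 0 < P.
Proof. exact: lt_le_trans pP. Qed.

Let k0 : 0 < k.
Proof. by rewrite lt_min divr_gt0//= mulr_gt0// (lt_le_trans ltr01). Qed.

Let n_ge0 t : 0 <= n t. Proof. exact: L2norm_ge0. Qed.

Let near_pos (t : R) : 0 < t -> \forall s \near t, 0 < s.
Proof. by move=> t0; exact: lt_nbhsr. Qed.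

(** * The energy of the heat equation *)

Let is_derive_n2 (t : R) : 0 < t -> is_derive t 1 n2 (2 * ip (w t) (wt t)).
Proof.
move=> t0; apply: is_derive_L2norm_sqr; [|exact: Lwt|exact: dw].
by apply: filterS (near_pos t0) => s s0; apply: Lw; exact: ltW.
Qed.

(* The reaction term is handled as [wt - p wxx], which is measurable whatever
   the regularity of [K]. *)
Let derive_n2_le (t : R) : 0 < t ->
  2 * ip (w t) (wt t) <= - 2 * P * n t ^+ 2 + 2 * `|th1 t| * n t * `|y t|.
Proof.
move=> t0; have H2 := wH2 t0.
have [Lf [Lf1 [Lf2 [_ [_ app]]]]] := H2.
pose G x := wt t x - p * wxx t x.
have LG : L2mem G by apply: L2memB; [exact: Lwt|exact: L2memZ].
have Gle : L2norm G <= `|th1 t| * `|y t|.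
  apply: L2norm_le_ae => //.
  apply: filterS (pde t0) => x H x01; rewrite /G H// addrC addKr normrM.
  by rewrite ler_wpM2l// KP.
have -> : ip (w t) (wt t) = p * ip (w t) (wxx t) + ip (w t) G.
  rewrite !(ipC (w t)) -ipZl// -ipDl//; last exact: L2memZ.
  by congr (ip _ _); apply/funext => x; rewrite /G addrC subrK.
rewrite (ip_weak_laplacian H2).
have h1 : ip (w t) G <= n t * (`|th1 t| * `|y t|).
  rewrite (le_trans (ler_norm _))// (le_trans (cauchy_schwarz_ip Lf LG))//.
  by rewrite ler_wpM2l ?L2norm_ge0.
have h2 : (pi * n t) ^+ 2 <= L2norm (wx t) ^+ 2.
  rewrite ler_pXn2r ?nnegrE ?mulr_ge0 ?pi_ge0 ?L2norm_ge0//.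
  exact: wirtinger.
have := ler_wpM2l (ltW p0) h2; rewrite exprMn mulrA -/P; lra.
Qed.

Let cvg_n (t : R) : 0 < t -> n s @[s --> t] --> n t.
Proof.
move=> t0; apply: cvg_L2norm; first by apply: Lw; exact: ltW.
  by apply: filterS (near_pos t0) => s s0; apply: Lw; exact: ltW.
apply: cvg_trans (cw (ltW t0)); apply: cvg_app => A /= H.
have H' : \forall s \near t, 0 <= s -> A s by exact: H.
by apply: filterS2 H' (near_pos t0) => s Hs /ltW /Hs.
Qed.

(** The derivative is at most [2 ||w|| ||w_t||], which is continuous, hence bounded, on compacts of
    ]0, +oo[. The point 0 is excluded because [wt] is not controlled there. *)
Let abs_cont_n2 s t : 0 < s -> s <= t -> abs_cont_on n2 s t.
Proof.
move=> s0 st; pose B r := n r * L2norm (wt r).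
have pos r : r \in `[s, t] -> 0 < r.
  by rewrite in_itv/= => /andP[sr _]; exact: lt_le_trans sr.
have cB : {within `[s, t], continuous B}.
  apply: continuous_in_subspaceT => r; rewrite inE => /pos r0.
  apply: cvgM; first exact: cvg_n.
  apply: cvg_L2norm; [exact: Lwt| |exact: cwt].
  by apply: filterS (near_pos r0) => x x0; exact: Lwt.
have [m mst Bm] := EVT_max st cB.
apply: (@bounded_derive1_abs_cont_on _ _ _ _ (2 * B m)).
  by rewrite mulr_ge0// mulr_ge0 ?L2norm_ge0.
move=> r rst; have r0 : 0 < r by apply: pos; rewrite in_itv.
have Dn := is_derive_n2 r0; split; first by case: Dn.
rewrite derive1E; have [_ ->] := Dn.
rewrite normrM ger0_norm// ler_wpM2l//.
have := cauchy_schwarz_ip (Lw (ltW r0)) (Lwt r0).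
by move=> /le_trans; apply; apply: Bm; rewrite in_itv.
Qed.

Let theta_ae : {ae mu, forall t, 0 < t -> th1 t ^+ 2 + th2 t ^+ 2 <= Th ^+ 2}.
Proof.
apply: filterS (Linf_norm_ae thP) => t H /ltW /H.
rewrite ger0_norm ?sqrtr_ge0// => H'.
have s0 : 0 <= th1 t ^+ 2 + th2 t ^+ 2 by rewrite addr_ge0 ?sqr_ge0.
rewrite -(sqr_sqrtr s0) ler_pXn2r ?nnegrE ?sqrtr_ge0//.
by rewrite (le_trans _ H')// sqrtr_ge0.
Qed.

Let b_gt0 : 0 < b. Proof. exact: lt_le_trans b1. Qed.

Let bZ_ge1 t : 1 <= b + expR (z t).
Proof. by rewrite (le_trans b1)// lerDl expR_ge0. Qed.

Let q_gt0 t : 0 < q t.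
Proof.
have B0 : 0 < b + expR (z t) by exact: lt_le_trans (bZ_ge1 t).
by rewrite /q divr_gt0 ?mulr_gt0 ?exprn_gt0.
Qed.

Let b_le_q t : b <= 4 * a * q t.
Proof.
have a5 : 0 < a ^+ 5 by rewrite exprn_gt0.
have -> : 4 * a * q t = (b + expR (z t)) ^+ 7 / a ^+ 5.
  by rewrite /q; field; rewrite lt0r_neq0.
rewrite ler_pdivlMr//.
have h1 : b + expR (z t) <= (b + expR (z t)) ^+ 7.
  by rewrite -[leLHS]expr1; apply: ler_weXn2l.
have h2 : b * a ^+ 5 <= b by rewrite ler_piMr ?(ltW b_gt0)// exprn_ile1// ltW.
by have := expR_ge0 (z t); lra.
Qed.

(** Multiplication by y makes the powers in the controller even, so everything can be expressed in
    |y| as the scalar estimates require. *)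
Let output_power_le (t : R) : 0 < t -> `|d t| <= D ->
  y t * (- c * (1 + (b + expR (z t)) ^+ 7 / (4 * a ^+ 6))
      * (y t ^+ 7 + y t ^+ 3 + y t) + th2 t * L (w t) + d t) <=
  - (c * (1 + q t) * (`|y t| ^+ 8 + `|y t| ^+ 4 + `|y t| ^+ 2))
  + `|th2 t| * n t * `|y t| + D * `|y t|.
Proof.
move=> t0 dD.
have L1 : `|L (w t)| <= n t by apply: LP; exists (wx t), (wxx t); exact: wH2.
have e j : `|y t| ^+ (2 * j) = y t ^+ (2 * j).
  by rewrite !exprM real_normK ?num_real.
rewrite (e 4%N) (e 2%N) (e 1%N).
have h1 : th2 t * L (w t) * y t <= `|th2 t| * n t * `|y t|.
  rewrite (le_trans (ler_norm _))// !normrM ler_wpM2r// ler_wpM2l//.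
have h2 : d t * y t <= D * `|y t|.
  by rewrite (le_trans (ler_norm _))// normrM ler_wpM2r.
rewrite -/(q t); lra.
Qed.

(** * Exponential bound on the total energy *)

Let C := 2 * a * D ^+ 2 / b + Th ^+ 4 / (2 * P ^+ 2).

Let energy_ae : {ae mu, forall t, 0 < t ->
  derivable (fun s => n2 s + y s * y s) t 1 /\
  derive1 (fun s => n2 s + y s * y s) t <= - k * (n2 t + y t * y t) + C}.
Proof.
apply: filterS3 dy (Linf_norm_ae dP) theta_ae => t Hy Hd Hth t0.
have [dyt y'] := Hy t0; have dD := Hd (ltW t0); have thT := Hth t0.
have Dy := derivableP dyt; have Dn := is_derive_n2 t0.
have DW : is_derive t 1 (fun s => n2 s + y s * y s)
    (2 * ip (w t) (wt t) + 2 * (y t * derive1 y t)).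
  by apply: is_derive_eq; rewrite derive1E /GRing.scale/=; ring.
split; first by case: DW.
rewrite derive1E; have [_ ->] := DW; rewrite y'.
(* The heat equation and the y-equation contribute [2 |theta_i| n |y|] for i = 1 and i = 2; both are
   treated at once with the sum as [tau]. *)
have tau2 : (`|th1 t| + `|th2 t|) ^+ 2 <= 2 * Th ^+ 2.
  have := sqr_ge0 (`|th1 t| - `|th2 t|).
  rewrite sqrrB sqrrD !real_normK ?num_real//; lra.
have kP : k <= P by rewrite ge_min -/P; apply/orP; left; have := P0; lra.
have kc : k <= 2 * c by rewrite ge_min lexx orbT.
have := energy_estimate (n t) `|y t| D P0 b_gt0 (q_gt0 t) c1 (b_le_q t) tau2 kP kc.
have := derive_n2_le t0; have := output_power_le t0 dD.
have yy : `|y t| ^+ 2 = y t * y t by rewrite real_normK ?num_real.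
rewrite -/(n2 t) /n2 -/(n t) -/C yy; lra.
Qed.

Let W0 := n2 0 + y 0 ^+ 2.

Let C_ge0 : 0 <= C.
Proof.
rewrite /C addr_ge0//.
  by rewrite divr_ge0 ?(ltW b_gt0)// mulr_ge0 ?sqr_ge0// mulr_ge0// ltW.
by rewrite divr_ge0 ?exprn_even_ge0// mulr_ge0// sqr_ge0.
Qed.

Let cvg_n0 : n s @[s --> 0^'+] --> n 0.
Proof.
apply: cvg_L2norm; first exact: Lw.
  by apply: filterS (nbhs_right_gt 0) => s /ltW; exact: Lw.
apply: cvg_trans (cw (lexx 0)); apply: cvg_app => A /= H.
have H' : \forall s \near (0 : R), 0 <= s -> A s by exact: H.
have : \forall s \near (0 : R), 0 < s -> A s.
  by apply: filterS H' => s Hs /ltW /Hs.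
by [].
Qed.

(** Since [n2] is known to be absolutely continuous only away from 0, Gronwall's lemma is applied on
    [s, t] and s tends to 0 by continuity of w and y. *)
Lemma closed_loop_energy t : 0 <= t ->
  n2 t + y t ^+ 2 <= expR (- k * t) * W0 + C / k.
Proof.
have Ck : 0 <= C / k by rewrite divr_ge0// ltW.
rewrite le_eqVlt => /predU1P[<-|t0].
  by rewrite mulr0 expR0 mul1r lerDl.
have [_ cy0] := (continuous_within_itvcyP _ _).1 cy.
have lim : (fun s => expR (- k * (t - s)) * (n2 s + y s * y s - C / k) + C / k)
    @ 0^'+ --> expR (- k * (t - 0)) * (n2 0 + y 0 * y 0 - C / k) + C / k.
  have cid : s @[s --> (0 : R)^'+] --> (0 : R) by apply: cvg_within; exact: cvg_id.
  apply: cvgD; last exact: cvg_cst.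
  apply: cvgM.
    apply: (@cvg_comp _ _ _ (fun s => - k * (t - s)) expR); last exact: continuous_expR.
    by apply: cvgM; [exact: cvg_cst|apply: cvgB => //; exact: cvg_cst].
  apply: cvgB; last exact: cvg_cst.
  apply: cvgD; last exact: cvgM.
  by rewrite /n2; under eq_fun do rewrite expr2; rewrite expr2; exact: cvgM.
have H : n2 t + y t * y t <=
    expR (- k * (t - 0)) * (n2 0 + y 0 * y 0 - C / k) + C / k.
  apply: (ler_cvg_to (cvg_cst (n2 t + y t * y t)) lim).
  have : \forall s \near (0 : R)^'+, 0 < s < t.
    apply: filterS2 (nbhs_right_gt 0) (nbhs_right_lt t0) => s s0 st.
    by rewrite s0.
  apply: filterS => s /andP[s0 st].
  apply: (@abs_cont_on_gronwall R (fun s => n2 s + y s * y s)) => //; first exact: ltW.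
    apply: abs_cont_onD; first exact: abs_cont_n2 (ltW st).
    by apply: abs_cont_onM; rewrite ?(ltW st)//;
      apply: abs_cont_onW (acy (ltW t0)) => //; exact: ltW.
  by apply: filterS energy_ae => x Hx /andP[sx _]; apply: Hx; exact: lt_trans sx.
move: H; rewrite subr0 -!expr2 -/W0 mulrBr => /le_trans; apply.
by rewrite lerD2r gerBl mulr_ge0 ?expR_ge0.
Qed.

Let n2_bounded t : 0 <= t ->
  n t ^+ 2 <= W0 + 2 * a * (D ^+ 2 + Th ^+ 8 + 2 / p ^+ 2) / (b * k)
              + Th ^+ 4 / (2 * P ^+ 2 * k).
Proof.
move=> t0.
have W00 : 0 <= W0 by rewrite addr_ge0 ?sqr_ge0.
have e1 : expR (- k * t) * W0 <= W0.
  by rewrite ler_piMl// expR_le1 mulNr oppr_le0 mulr_ge0// ltW.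
have Ck : C / k <= 2 * a * (D ^+ 2 + Th ^+ 8 + 2 / p ^+ 2) / (b * k)
              + Th ^+ 4 / (2 * P ^+ 2 * k).
  rewrite (_ : C / k = 2 * a * D ^+ 2 / (b * k) + Th ^+ 4 / (2 * P ^+ 2 * k)).
    rewrite lerD2r ler_pM2r ?invr_gt0 ?mulr_gt0// ler_pM2l ?mulr_gt0//.
    by rewrite -addrA lerDl addr_ge0 ?exprn_even_ge0// divr_ge0// sqr_ge0.
  by rewrite /C; field; rewrite !lt0r_neq0.
have := closed_loop_energy t0; have := sqr_ge0 (y t).
rewrite /n2 -/(n t); lra.
Qed.

(** * The output inequality and the bounds on the adaptive gain *)

Let S := D ^+ 2 + Th ^+ 4 + Th ^+ 8 + 2 / p ^+ 2 + W0.
(** This is the [Kbar] of the theorem with its fraction split into four terms. *)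
Let Kb := 1 + a * P / (b * k) + P / 2 + (4 * P * k)^-1.
Let v t := y t * y t / 2.

Let W0_ge0 : 0 <= W0. Proof. by rewrite addr_ge0 ?sqr_ge0. Qed.

Let S_gt0 : 0 < S.
Proof.
(* The summand [2 / p^2] keeps [S] positive even when all data vanish. *)
rewrite ltr_wpDr// ltr_wpDl ?divr_gt0 ?exprn_gt0//.
by rewrite !addr_ge0 ?sqr_ge0 ?exprn_even_ge0.
Qed.

Let Kb_gt0 : 0 < Kb.
Proof.
have h1 : 0 <= a * P / (b * k) by rewrite divr_ge0// mulr_ge0// ltW.
have h2 : 0 <= (4 * P * k)^-1.
  by rewrite invr_ge0 mulr_ge0 ?(ltW k0)// mulr_ge0// ltW.
rewrite /Kb; have := P0; lra.
Qed.

Let A := a * (Kb * S).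

Let A_gt0 : 0 < A. Proof. by rewrite !mulr_gt0. Qed.

Let v_ge0 t : 0 <= v t.
Proof. by rewrite /v divr_ge0// -expr2 sqr_ge0. Qed.

Let abs_cont_v T : 0 <= T -> abs_cont_on v 0 T.
Proof.
move=> T0; apply: (@abs_cont_onM _ (fun t => y t * y t) (cst 2^-1)) => //.
  by apply: abs_cont_onM => //; exact: acy.
apply: (@lipschitz_abs_cont_on _ _ _ _ 0) => // *.
by rewrite subrr normr0 mul0r.
Qed.

Let output_ae : {ae mu, forall t, 0 < t -> derivable v t 1 /\
  derive1 v t <= - (2 * c) * v t + A / (b + expR (z t))}.
Proof.
apply: filterS3 dy (Linf_norm_ae dP) theta_ae => t Hy Hd Hth t0.
have [dyt y'] := Hy t0; have dD := Hd (ltW t0); have thT := Hth t0.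
have Dy := derivableP dyt.
have Dv : is_derive t 1 v (y t * derive1 y t).
  rewrite /v; apply: is_derive_eq; rewrite derive1E /GRing.scale/=.
  by field.
split; first by case: Dv.
rewrite derive1E; have [_ ->] := Dv; rewrite y'.
have tau2 : `|th2 t| ^+ 2 <= Th ^+ 2.
  by rewrite real_normK ?num_real//; have := sqr_ge0 (th1 t); lra.
have B0 : 0 < b + expR (z t) by exact: lt_le_trans (bZ_ge1 t).
pose r := a / (b + expR (z t)).
have r0 : 0 < r by rewrite divr_gt0.
have r1 : r <= 1 by rewrite ler_pdivrMr// mul1r (le_trans a1).
(* The sixth powers of [a] cancel and one factor [b + Z >= 1] survives: this is the purpose of the
   exponents 7 and 6 in the controller. *)
have qr : 1 <= 4 * q t * r ^+ 6.
  rewrite (_ : 4 * q t * r ^+ 6 = b + expR (z t))// /q /r.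
  by field; rewrite !lt0r_neq0.
have h1 := output_estimate (n t) `|y t| D p0 pP r0 r1 qr c1 (ltW (q_gt0 t)) tau2.
have kP : k <= P / 2 by rewrite ge_min lexx.
have h2 := gain_estimate p0 P0 a0 b_gt0 k0 kP W0_ge0 (n2_bounded (ltW t0)).
have h3 := ler_wpM2l (ltW r0) h2.
have h4 := output_power_le t0 dD.
have yy : `|y t| ^+ 2 = 2 * v t by rewrite real_normK ?num_real// /v; field.
have -> : A / (b + expR (z t)) = r * (Kb * S).
  by rewrite /A /r; field; rewrite lt0r_neq0.
move: h1 h3 h4; rewrite -/S -/Kb yy; lra.
Qed.

Let Z t := expR (z t).

Let cZ : {within `[0, +oo[, continuous Z}.
Proof.
by move=> t; apply: (@cvg_comp _ _ _ z expR); [exact: cz|exact: continuous_expR].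
Qed.

Let dZ t : 0 < t -> derivable Z t 1 /\
  derive1 Z t = Gam * ppart (v t - eps).
Proof.
move=> t0; have [dzt z'] := dz t0; have Dz := derivableP dzt.
have DZ : is_derive t 1 Z (expR (z t) * 'D_1 z t).
  exact: (@is_derive1_comp _ expR z).
split; first by case: DZ.
rewrite derive1E; have [_ ->] := DZ; rewrite -derive1E z' expr2 -/(v t).
by rewrite mulrA mulrCA -expRD subrr expR0 mulr1.
Qed.

Let Z_ge0 t : 0 <= Z t. Proof. exact: expR_ge0. Qed.

Let c2_gt0 : 0 < 2 * c. Proof. by have := c1; lra. Qed.

Lemma closed_loop_gain_nondecreasing t : 0 <= t -> z 0 <= z t.
Proof.
move=> t0; rewrite -ler_expR.
exact: (deadzone_nondecreasing Gam0 cZ dZ (lexx 0) t0).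
Qed.

Lemma closed_loop_gain_bounded t : 0 <= t ->
  expR (z t) <= expR (z 0) +
    (a * Kb * (eps * Gam + 2 * c) + eps * c * Gam) / (4 * c ^+ 2 * eps) * S.
Proof.
move=> t0.
have c0 : 0 < c by exact: lt_le_trans c1.
have := deadzone_bounded c2_gt0 eps0 Gam0 A_gt0 b1 v_ge0 Z_ge0 abs_cont_v
  output_ae cZ dZ t0.
move=> /le_trans; apply; rewrite -addrA lerD2l.
have vS : 2 * v 0 <= S.
  have n0 : 0 <= n2 0 by exact: sqr_ge0.
  have h1 := sqr_ge0 D.
  have h2 : 0 <= Th ^+ 4 by rewrite exprn_even_ge0.
  have h3 : 0 <= Th ^+ 8 by rewrite exprn_even_ge0.
  have h4 : 0 <= 2 / p ^+ 2 by rewrite divr_ge0// sqr_ge0.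
  by rewrite /v /S /W0 expr2; lra.
(* The dead-zone bound with [k = 2 c] contains [Gam v(0) / (2 c)], where the claimed constant has
   [Gam S / (4 c)]; all other terms agree. *)
rewrite -subr_ge0 (_ : _ - _ = Gam / (4 * c) * (S - 2 * v 0)); last first.
  by rewrite /A; field; rewrite !lt0r_neq0.
by rewrite mulr_ge0 ?subr_ge0// divr_ge0 ?ltW// mulr_gt0.
Qed.

(** * Upper limits of the output and of the state *)

Let output_attractive (e : R) : 0 < e ->
  \forall t \near +oo%R, `|y t| <= Num.sqrt (2 * eps) + e.
Proof.
(* With this margin on [v], [y^2 < 2 eps + e^2], which is at most [(sqrt(2 eps) + e)^2]. *)
move=> e0; have e2 : 0 < e ^+ 2 / 2 by rewrite divr_gt0// exprn_gt0.
have := deadzone_attractive c2_gt0 eps0 Gam0 A_gt0 b1 v_ge0 Z_ge0 abs_cont_v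
  output_ae cZ dZ e2.
apply: filterS => t vt.
have s0 : 0 <= Num.sqrt (2 * eps) by exact: sqrtr_ge0.
have se : Num.sqrt (2 * eps) ^+ 2 = 2 * eps.
  by rewrite sqr_sqrtr// mulr_ge0// ltW.
rewrite -(@ler_pXn2r _ 2)// ?nnegrE ?addr_ge0 ?(ltW e0)//.
rewrite real_normK ?num_real// sqrrD se expr2.
have := mulr_ge0 s0 (ltW e0); move: vt; rewrite /v -mulr_natl; lra.
Qed.

Lemma closed_loop_limsup_output :
  (limf_esup (fun t => (`|y t|)%:E) (pinfty_nbhs R) <= (Num.sqrt (2 * eps))%:E)%E.
Proof. by apply: limf_esup_pinfty_le => e; exact: output_attractive. Qed.

Let expR_small (m e s : R) : 0 < e -> 0 <= m ->
  \forall t \near +oo%R, expR (- P * (t - s)) * m <= e.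
Proof.
(* Beyond this time [1 + P (t - s) > m / e], and the exponential of [P (t - s)] is larger still. *)
move=> e0 m0; exists (s + m / (e * P)); split; first exact: num_real.
move=> t st; have ts : 0 < t - s.
  rewrite subr_gt0; apply: le_lt_trans st; rewrite lerDl divr_ge0//.
  by rewrite mulr_ge0// ltW.
have : m / (e * P) < t - s by rewrite ltrBrDl.
rewrite ltr_pdivrMr; last exact: mulr_gt0.
move=> mt.
have Pt : 0 < P * (t - s) by rewrite mulr_gt0.
have := expR_ge1Dx (P * (t - s)) => ge1.
rewrite mulNr expRN mulrC ler_pdivrMr ?expR_gt0//.
have := ler_wpM2l (ltW e0) ge1; lra.
Qed.

(** Eventually |theta_1| |y| is below a constant [G] close to the product of the two limits. Then
    [n2' <= - P n2 + G^2 / P], whose equilibrium is [(G / P)^2]. *)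
Lemma closed_loop_limsup_state :
  (limf_esup (fun t => (L2norm (w t))%:E) (pinfty_nbhs R) <=
   (Num.sqrt (2 * eps) / P)%:E *
     limf_esup (fun t => (`|th1 t|)%:E) (pinfty_nbhs R))%E.
Proof.
set s := Num.sqrt (2 * eps).
have s0 : 0 < s by rewrite sqrtr_gt0 mulr_gt0.
have : (0 <= limf_esup (fun t => (`|th1 t|)%:E) (pinfty_nbhs R))%E.
  apply: limf_esup_ge0 => [/filter_ex[]//|t]; by rewrite lee_fin.
(* An infinite upper limit of |theta_1| makes the right-hand side infinite, as its coefficient is
   positive. *)
case E : (limf_esup _ _) => [l| |] // l0; last first.
  by rewrite gt0_muley ?leey// lte_fin divr_gt0.
rewrite lee_fin in l0; rewrite -EFinM.
apply: limf_esup_pinfty_le => e e0.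
(* As [g <= 1], [(l + g) (s + g) <= l s + g (l + s + 1)], and the second bound on [g] makes the
   excess at most [e P / 2]. *)
pose g := minr 1 (e * P / (2 * (l + s + 1))).
have ls0 : 0 < l + s + 1 by have := s0; lra.
have g0 : 0 < g by rewrite lt_min ltr01/= divr_gt0//; exact: mulr_gt0.
have g1 : g <= 1 by rewrite ge_min lexx.
have ge : g * (l + s + 1) <= e * P / 2.
  have : g <= e * P / (2 * (l + s + 1)) by rewrite ge_min lexx orbT.
  rewrite ler_pdivlMr ?mulr_gt0//; lra.
pose G := (l + g) * (s + g).
have G0 : 0 <= G by rewrite mulr_ge0// addr_ge0// ltW.
have GP : G / P + e / 2 <= s / P * l + e.
  have : G <= s * l + e * P / 2 by rewrite /G; nra.
  rewrite -(@ler_pM2r _ P^-1) ?invr_gt0// mulrDl.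
  rewrite [e * P / 2 / P](_ : _ = e / 2); last by field; rewrite lt0r_neq0.
  lra.
have near1 : \forall t \near +oo%R, `|th1 t| * `|y t| <= G.
  have H1 : \forall t \near +oo%R, `|th1 t| < l + g.
    by apply: limf_esup_pinfty_lt; rewrite E lte_fin ltrDl.
  apply: filterS2 H1 (output_attractive g0) => t t1 t2.
  by rewrite ler_pM// ltW.
have [T [_ HT]] := near1.
(* A positive starting time, since [abs_cont_n2] holds on segments that avoid 0. *)
pose T1 := maxr T 0 + 1.
have T10 : 0 < T1 by rewrite ltr_wpDl// le_max lexx orbT.
have TT1 : T < T1 by rewrite (@le_lt_trans _ _ (maxr T 0)) ?ltrDl// le_max lexx.
have e40 : 0 < e ^+ 2 / 4 by rewrite divr_gt0// exprn_gt0.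
have near2 := expR_small T1 e40 (sqr_ge0 (n T1)).
have near3 : \forall t \near +oo%R, T1 <= t.
  by apply: nbhs_pinfty_ge; exact: num_real.
apply: filterS2 near2 near3 => t tsmall T1t.
have := @abs_cont_on_gronwall R n2 P (G ^+ 2 / P) T1 t P0 T1t (abs_cont_n2 T10 T1t).
move=> /(_ _)/wrap[|H].
  apply: nearW => x /andP[T1x _]; have x0 := lt_trans T10 T1x.
  have Dn := is_derive_n2 x0; split; first by case: Dn.
  rewrite derive1E; have [_ ->] := Dn; apply: le_trans (derive_n2_le x0) _.
  have h1 := ler_wpM2r (n_ge0 x) (HT x (lt_trans TT1 T1x)).
  have := young2 (n x) G P0; rewrite /n2 -/(n x); lra.
(* The initial energy has decayed below [e^2 / 4], so [n^2 <= (G / P)^2 + e^2 / 4 <= (G / P + e /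
   2)^2]. *)
have GPP : G ^+ 2 / P / P = (G / P) ^+ 2 by field; rewrite lt0r_neq0.
rewrite GPP in H.
apply: le_trans GP.
rewrite -(@ler_pXn2r _ 2)// ?nnegrE ?L2norm_ge0 ?addr_ge0 ?divr_ge0 ?(ltW e0) ?(ltW P0)//.
apply: (le_trans H).
have h2 : 0 <= expR (- P * (t - T1)) * (G / P) ^+ 2.
  by rewrite mulr_ge0 ?expR_ge0 ?sqr_ge0.
have h3 : 0 <= G / P * e by rewrite mulr_ge0 ?divr_ge0 ?(ltW e0) ?(ltW P0).
rewrite sqrrD mulrBr; move: tsmall; rewrite -/(n2 T1) /n2 -/(n T1) expr_div_n; lra.
Qed.

End closed_loop.

(** * Assembly of the four estimates with their explicit constants *)

Theorem theorem3 (R : realType) (p eps Gam c a b : R)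
  (K : R -> R -> R) (L : (R -> R) -> R)
  (d th1 th2 : R -> R)
  (w wt wx wxx : R -> R -> R) (y z : R -> R) :
  0 < p -> 0 < eps -> 0 < Gam -> 1 <= c -> 1 <= b -> a <= 1 -> 0 < a ->
  (forall x v, 0 <= x <= 1 -> `|K x v| <= `|v|) ->
  (forall f, H2H01 f -> `|L f| <= L2norm f) ->
  (* d in L^infty(R_+) *)
  Linf_Rplus d ->
  (* theta in C^0(R_+;R^2) /\ L^infty(R_+;R^2) *)
  {within `[0, +oo[, continuous th1} -> {within `[0, +oo[, continuous th2} ->
  Linf_Rplus (fun t => Num.sqrt (th1 t ^+ 2 + th2 t ^+ 2)) ->
  (* w in C^0(R_+; L^2(0,1)) *)
  (forall t, 0 <= t -> L2mem (w t)) ->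
  (forall t, 0 <= t ->
     (fun s => L2norm (fun x => w s x - w t x))
       @ within (fun s => 0 <= s) (nbhs t) --> 0) ->
  (* w in C^1((0,+oo); L^2(0,1)), with time derivative wt *)
  (forall t, 0 < t -> L2mem (wt t)) ->
  (forall t, 0 < t ->
     (fun h => L2norm (fun x => h^-1 * (w (t + h) x - w t x) - wt t x))
       @ 0^' --> 0) ->
  (forall t, 0 < t ->
     (fun s => L2norm (fun x => wt s x - wt t x)) @ t --> 0) ->
  (* w in C^0((0,+oo); H^2(0,1) /\ H_0^1(0,1)), with weak derivatives wx, wxx *)
  (forall t, 0 < t -> inH2H01 (w t) (wx t) (wxx t)) ->
  (forall t, 0 < t ->
     (fun s => L2norm (fun x => w s x - w t x) + L2norm (fun x => wx s x - wx t x)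
               + L2norm (fun x => wxx s x - wxx t x)) @ t --> 0) ->
  (* z in C^1(R_+) *)
  (exists z' : R -> R, {within `[0, +oo[, continuous z'} /\
     forall t, 0 <= t ->
       (fun h => h^-1 * (z (t + h) - z t))
         @ within (fun h => h != 0 /\ 0 <= t + h) (nbhs 0) --> z' t) ->
  (* y in C^0(R_+), absolutely continuous on compacts *)
  {within `[0, +oo[, continuous y} ->
  (forall T, 0 <= T -> abs_cont_on y 0 T) ->
  (* the PDE, for all t > 0 (as an equality in L^2(0,1)) *)
  (forall t, 0 < t ->
     {ae @lebesgue_measure R, forall x, 0 <= x <= 1 ->
        wt t x = p * wxx t x + th1 t * K x (y t)}) ->
  (* the z-equation, for all t > 0 *)
  (forall t, 0 < t -> derivable z t 1 /\
     derive1 z t = Gam * expR (- z t) * ppart (y t ^+ 2 / 2 - eps)) ->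
  (* the y-equation with u substituted, for a.e. t > 0 *)
  {ae @lebesgue_measure R, forall t, 0 < t ->
     derivable y t 1 /\
     derive1 y t =
       - c * (1 + (b + expR (z t)) ^+ 7 / (4 * a ^+ 6))
           * (y t ^+ 7 + y t ^+ 3 + y t)
       + th2 t * L (w t) + d t} ->
  let kappa := Num.min (p * pi ^+ 2 / 2) (2 * c) in
  let Kbar := (4 * p * pi ^+ 2 * (b * kappa + a * p * pi ^+ 2)
               + 2 * b * kappa * p ^+ 2 * pi ^+ 4 + b)
              / (4 * p * pi ^+ 2 * b * kappa) in
  let Bbar := (a * Kbar * (eps * Gam + 2 * c) + eps * c * Gam)
              / (4 * c ^+ 2 * eps) in
  let D := Linf_norm d in
  let Th := Linf_norm (fun t => Num.sqrt (th1 t ^+ 2 + th2 t ^+ 2)) in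
  (forall t, 0 <= t ->
     L2norm (w t) ^+ 2 + y t ^+ 2 <=
       expR (- kappa * t) * (L2norm (w 0) ^+ 2 + y 0 ^+ 2)
       + 2 * a * (D ^+ 2 + Th ^+ 8 + 2 / p ^+ 2) / (b * kappa)
       + Th ^+ 4 / (2 * p ^+ 2 * pi ^+ 4 * kappa)) /\
  (forall t, 0 <= t ->
     z 0 <= z t /\
     z t <= ln (expR (z 0) + Bbar * (D ^+ 2 + Th ^+ 4 + Th ^+ 8 + 2 / p ^+ 2
                                     + L2norm (w 0) ^+ 2 + y 0 ^+ 2))) /\
  (limf_esup (fun t => (L2norm (w t))%:E) (pinfty_nbhs R) <=
     (Num.sqrt (2 * eps) / (p * pi ^+ 2))%:E
       * limf_esup (fun t => (`|th1 t|)%:E) (pinfty_nbhs R))%E /\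
  (limf_esup (fun t => (`|y t|)%:E) (pinfty_nbhs R) <=
     (Num.sqrt (2 * eps))%:E)%E.
Proof.
move=> p0 eps0 Gam0 c1 b1 a1 a0 KP LP dP _ _ thP Lw cw Lwt dw cwt wH2 _.
move=> [z' [_ z'P]] cy acy pde dz dy kappa Kbar Bbar D Th.
have pi2 : pi ^+ 2 != 0 :> R by rewrite lt0r_neq0// exprn_gt0// pi_gt0.
have pi4 : pi ^+ 4 = (pi ^+ 2) ^+ 2 :> R by rewrite -exprM.
have b0 : 0 < b by exact: lt_le_trans b1.
have k0 : 0 < kappa.
  rewrite lt_min divr_gt0 ?mulr_gt0 ?exprn_gt0 ?pi_gt0//=.
  exact: lt_le_trans c1.
(* Continuity up to t = 0 comes from the one-sided difference quotient of z there. *)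
have cz : {within `[0, +oo[, continuous z}.
  apply: derivable_within_itvcy_continuous (z'P 0 (lexx 0)) => t t0.
  by have [] := dz t t0.
have KbarE : 1 + a * (p * pi ^+ 2) / (b * kappa) + p * pi ^+ 2 / 2 +
    (4 * (p * pi ^+ 2) * kappa)^-1 = Kbar.
  (* Generalizing [pi ^+ 2] to a nonzero variable leaves [field] a rational identity in which
     [pi ^+ 4] is its square. *)
  rewrite /Kbar pi4; move: (pi ^+ 2) pi2 => s s0; field.
  by rewrite s0 !lt0r_neq0.
split; [|split; [|split]].
- move=> t t0.
  have := closed_loop_energy p0 c1 b1 a1 a0 KP LP dP thP Lw cw Lwt dw cwt wH2
    cy acy pde dy t0.
  (* The energy bound is sharper: the stated constant also contains the nonnegative terms with
     [Th ^+ 8] and [2 / p ^+ 2]. *)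
  move=> /le_trans; apply; rewrite -!addrA lerD2l.
  rewrite -/kappa -/D -/Th mulrDl lerD//.
    rewrite -mulrA -invfM ler_pM2r ?invr_gt0 ?mulr_gt0// ler_pM2l ?mulr_gt0//.
    by rewrite lerDl addr_ge0 ?exprn_even_ge0// divr_ge0// sqr_ge0.
  rewrite le_eqVlt pi4; apply/orP; left; apply/eqP.
  move: (pi ^+ 2) pi2 => s s0; field.
  by rewrite s0 !lt0r_neq0.
- move=> t t0; split.
    exact: (closed_loop_gain_nondecreasing Gam0 cz dz t0).
  have H := closed_loop_gain_bounded p0 eps0 Gam0 c1 b1 a1 a0 KP LP dP thP Lw cw
    Lwt dw cwt wH2 cz cy acy pde dz dy t0.
  rewrite KbarE !addrA in H.
  rewrite -[leLHS]expRK ler_ln ?posrE ?expR_gt0//.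
  exact: lt_le_trans (expR_gt0 _) H.
- exact: (closed_loop_limsup_state p0 eps0 Gam0 c1 b1 a1 a0 KP LP dP thP Lw cw
    Lwt dw cwt wH2 cz cy acy pde dz dy).
exact: (closed_loop_limsup_output p0 eps0 Gam0 c1 b1 a1 a0 KP LP dP thP Lw cw
  Lwt dw cwt wH2 cz cy acy pde dz dy).
Qed.
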